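(* Let $\mathbf{\Sigma}\in\mathbb{R}^{d\times d}$ be symmetric PSD with eigenvalues $\lambda_1>\lambda_2\ge\dots\ge\lambda_d$, eigenvectors $v_1,\dots,v_d$, $\mathrm{gap}=(\lambda_1-\lambda_2)/\lambda_1$, and $\mathbf{B}=\lambda\mathbf{I}-\mathbf{\Sigma}$ with $\left(1+\frac{\mathrm{gap}}{150}\right)\lambda_1\le\lambda\le\left(1+\frac{\mathrm{gap}}{100}\right)\lambda_1$. Let $x_0=x/\|x\|_2$ with $x\sim\mathcal{N}(0,\mathbf{I})$. Suppose we have a subroutine $\mathrm{solve}(\cdot)$ such that for every unit vector $x$, $$\mathbb{E}\|\mathrm{solve}(x)-\mathbf{B}^{-1}x\|_{\mathbf{B}}\le\frac1{3000\,\kappa(\mathbf{B}^{-1})d^{21}}\left\|\frac1{\lambda-\mathrm{quot}(x)}x-\mathbf{B}^{-1}x\right\|_{\mathbf{B}},$$ where $\kappa(\mathbf{B}^{-1})=\lambda_1(\mathbf{B}^{-1})/\lambda_d(\mathbf{B}^{-1})$. Then the procedure $x_t=\mathrm{solve}(x_{t-1})/\|\mathrm{solve}(x_{t-1})\|$, after $T=O(\log d+\log\kappa(\mathbf{B}^{-1}))$ iterations, satisfies $G(x_T)\le\frac1{\sqrt{10}}$ with probability greater than $1-O(1/d^{10})$.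
   Context: $\mathrm{quot}(y)=\frac{y^\top\mathbf{\Sigma}y}{y^\top y}$; $\|y\|_{\mathbf{B}}=\sqrt{y^\top\mathbf{B}y}$; for $y$ with $v_1^\top y\ne0$, $G(y)=\frac{\|\mathbf{P}_{v_1^\perp}y\|_{\mathbf{B}}}{\|\mathbf{P}_{v_1}y\|_{\mathbf{B}}}$ with $\mathbf{P}_{v_1},\mathbf{P}_{v_1^\perp}$ the orthogonal projections onto $\mathrm{span}(v_1)$ and its orthogonal complement. $\lambda_i(\mathbf{B}^{-1})$ is the $i$-th largest eigenvalue of $\mathbf{B}^{-1}$. *)

(* Defs.v *)
From HB Require Import structures.
From mathcomp Require Import all_boot all_order all_algebra.
From mathcomp Require Import all_classical all_reals all_analysis.

Set Implicit Arguments.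
Unset Strict Implicit.
Unset Printing Implicit Defensive.

Import Order.TTheory GRing.Theory Num.Theory.
Import numFieldNormedType.Exports.

Local Open Scope classical_set_scope.
Local Open Scope ring_scope.

(* Matrices carry the product sigma-algebra, i.e. the smallest one making every
   entry measurable; over a realType this is the Borel sigma-algebra. *)
Definition measure_matrix_display : measure_display -> measure_display.
Proof. exact. Qed.

Section measurable_matrix.
Context {d} {T : measurableType d} {m n : nat}.

Definition matrix_entry_preimages : set (set 'M[T]_(m, n)) :=
  \bigcup_(ij in [set: 'I_m * 'I_n])
    preimage_set_system setT (fun M : 'M[T]_(m, n) => M ij.1 ij.2) measurable.

Let matrix_set0 : <<s matrix_entry_preimages >> set0.
Proof. exact: sigma_algebra0. Qed.

Let matrix_setC A :
  <<s matrix_entry_preimages >> A -> <<s matrix_entry_preimages >> (~` A).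
Proof. exact: sigma_algebraC. Qed.

Let matrix_bigcup (F : (set 'M[T]_(m, n))^nat) :
  (forall i, <<s matrix_entry_preimages >> (F i)) ->
  <<s matrix_entry_preimages >> (\bigcup_i F i).
Proof. exact: sigma_algebra_bigcup. Qed.

HB.instance Definition _ := @isMeasurable.Build (measure_matrix_display d)
  'M[T]_(m, n) <<s matrix_entry_preimages >>
  matrix_set0 matrix_setC matrix_bigcup.

End measurable_matrix.

Section linear_algebra.
Context {R : realType} {d : nat}.
Implicit Types (A B S : 'M[R]_d) (x y v : 'cV[R]_d).

Definition qform A y : R := (y^T *m A *m y) 0 0.

Definition psd A : Prop := A^T = A /\ forall y, 0 <= qform A y.

Definition dotv x y : R := (x^T *m y) 0 0.

Definition norm2 y : R := Num.sqrt (dotv y y).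

(* Sends 0 to 0, as 0^-1 = 0. *)
Definition normalize y : 'cV[R]_d := (norm2 y)^-1 *: y.

Definition quot S y : R := qform S y / dotv y y.

Definition mxnorm B y : R := Num.sqrt (qform B y).

Definition Pspan v : 'M[R]_d := (dotv v v)^-1 *: (v *m v^T).

Definition Pperp v : 'M[R]_d := 1%:M - Pspan v.

(* Only meaningful when dotv v1 y != 0. *)
Definition G B v1 y : R := mxnorm B (Pperp v1 *m y) / mxnorm B (Pspan v1 *m y).

Definition eigensystem S (lam : 'I_d -> R) (v : 'I_d -> 'cV[R]_d) : Prop :=
  [/\ forall i, S *m v i = lam i *: v i,
      forall i j, dotv (v i) (v j) = (i == j)%:R
    & forall i j : 'I_d, (i <= j)%N -> lam j <= lam i].

(* The eigenvalues with multiplicity in nonincreasing order, provided the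
   characteristic polynomial splits over R (always so for symmetric A). *)
Definition eigenvalues A : seq R :=
  xget [::] [set s : seq R |
    sorted >=%R s /\ char_poly A = \prod_(a <- s) ('X - a%:P)].

(* The index is 0-based: eigenval A 0 is the largest eigenvalue. *)
Definition eigenval A (i : nat) : R := nth 0 (eigenvalues A) i.

Definition cond A : R := eigenval A 0 / eigenval A d.-1.

End linear_algebra.

Section probability_notions.
Context {R : realType} {dO} {Omega : measurableType dO}.
Variable P : probability Omega R.

Definition mutually_independent (I : choiceType) (F : I -> set (set Omega)) :
    Prop :=
  forall (J : seq I) (A : I -> set Omega), uniq J ->
    (forall i, i \in J -> F i (A i)) ->
    P (\bigcap_(i in [set` J]) A i) = (\big[*%E/1%E]_(i <- J) P (A i))%E.

Definition std_gaussian {d : nat} (g : {RV P >-> 'cV[R]_d}) : Prop :=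
  mutually_independent
    (fun i : 'I_d => g_sigma_algebra_preimage (fun w => g w i 0 : R)) /\
  forall (i : 'I_d) (A : set R), measurable A ->
    P [set w | A (g w i 0)] = normal_prob 0 1 A.

(* xi_0, xi_1, ... is the fresh internal randomness of the successive calls of
   a randomized subroutine: i.i.d. of law Q and independent of the input g. *)
Definition fresh_seeds {d : nat} (g : {RV P >-> 'cV[R]_d})
    {dX} {Xi : measurableType dX} (Q : probability Xi R)
    (xi : nat -> {RV P >-> Xi}) : Prop :=
  (forall t (A : set Xi), measurable A -> distribution P (xi t) A = Q A) /\
  mutually_independent (fun o : option nat =>
    if o is Some t then g_sigma_algebra_preimage (xi t)
    else g_sigma_algebra_preimage g).

End probability_notions.

(* solve y s is the output of the subroutine on input y with seed s. *)
Fixpoint iterates {R : realType} {d : nat} {Omega Xi : Type}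
    (solve : 'cV[R]_d -> Xi -> 'cV[R]_d) (g : Omega -> 'cV[R]_d)
    (xi : nat -> Omega -> Xi) (t : nat) (w : Omega) : 'cV[R]_d :=
  if t is t'.+1 then
    normalize (solve (iterates solve g xi t' w) (xi t' w))
  else normalize (g w).

(* Main.v *)
(* Write c_i = v_i . x and b_i = lambda - lambda_i, so that
   G(x)^2 = (sum_(i > 1) b_i c_i^2) / (b_1 c_1^2) and b_i >= 101 b_1 for i > 1.
   Since 1 / (lambda - quot x) is the best multiplier of x in the B-norm, the
   expected error of solve, relative to the first component of B^-1 x, is at
   most eps G(x). By Markov it is at most 1/8 except with probability
   8 eps G(x), and then G^2 becomes at most G^2 / 16 + 2 / 49. Hence, given
   G(x_0) <= M, all T steps contract except with probability
   eps (16 M + 2 T).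

   For the Gaussian start, conditioning on all coordinates but the one where
   v_1 is largest gives P(|v_1 . g| < t) <= 2 d t without using rotation
   invariance. This loses a power of d, and the worst case M = kappa d^14
   allowed by |v_1 . g| >= d^-11 only gives a failure probability of order
   d^-7; but the starts with |v_1 . g| < d^-4 have probability O(d^-3), and for
   the others M = kappa d^7 is enough. *)

Require Import Defs.
From mathcomp Require Import all_boot all_order all_algebra.
From mathcomp Require Import all_classical all_reals all_analysis.
From mathcomp Require Import measurable_realfun ring lra.

Set Implicit Arguments.
Unset Strict Implicit.
Unset Printing Implicit Defensive.

Import Order.TTheory GRing.Theory Num.Theory.
Import numFieldNormedType.Exports.

Local Open Scope classical_set_scope.
Local Open Scope ring_scope.

(** * Independence *)

(** For fixed [B] both sides are finite measures in [A]. They agree on finite intersections of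
    members of the [F i], a pi-system generating the sigma-algebra, hence everywhere on it. *)
Lemma mutually_independent_group (R : realType) (dO : measure_display)
    (Omega : measurableType dO) (P : probability Omega R) (I : choiceType)
    (F : I -> set (set Omega)) (J : seq I) (k : I) :
  (forall i, F i `<=` measurable) -> (forall i, F i setT) ->
  (forall i, setI_closed (F i)) ->
  mutually_independent P F -> uniq J -> k \notin J ->
  forall A B, <<s \bigcup_(i in [set` J]) F i >> A -> F k B ->
    P (A `&` B) = (P A * P B)%E.
Proof.
move=> Fm FT FI indF uJ kJ A B sA FB.
have mB : measurable B by exact: Fm FB.
pose C : set (set Omega) := [set X | exists2 f : I -> set Omega,
  (forall i, F i (f i)) & X = \bigcap_(i in [set` J]) f i].
have Cm : C `<=` measurable.
  move=> _ [f Ff ->]; apply: fin_bigcap_measurable => // i _.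
  exact: Fm (Ff i).
have CI : setI_closed C.
  move=> _ _ [f Ff ->] [h Fh ->]; exists (fun i => f i `&` h i).
    by move=> i; apply: FI.
  by rewrite bigcapI.
have CT : C setT.
  by exists (fun=> setT) => //; rewrite bigcapT.
(* A single member of [F i] becomes such an intersection once padded with [setT] at the other
   indices. *)
have FC : \bigcup_(i in [set` J]) F i `<=` C.
  move=> X [i iJ FX]; exists (fun j => if j == i then X else setT).
    by move=> j; case: eqP => [->|].
  apply/seteqP; split=> [w Xw j /= _|w /(_ i iJ)]; last by rewrite eqxx.
  by case: eqP.
have {sA} sA : <<s C >> A by apply: sub_sigma_algebra2 sA; exact: FC.
pose m1 := mrestr P mB.
have PB0 : (0 <= fine (P B))%R by apply: fine_ge0.
pose m2 := mscale (NngNum PB0) P.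
have m2E X : m2 X = (P X * P B)%E.
  by rewrite /m2 /mscale /= fineK ?fin_num_measure// muleC.
rewrite -m2E; apply: (g_sigma_algebra_measure_unique C Cm (fun=> setT)
  (fun=> CT) _ m1 m2 CI) => //.
- by rewrite bigcup_const.
- move=> X CX; transitivity (P X * P B)%E; last by rewrite -m2E.
  rewrite /= /mrestr; have [f Ff XE] := CX.
  have indX : P X = (\big[*%E/1%E]_(i <- J) P (f i))%E.
    by rewrite XE; apply: indF.
  (* Placing [B] at the fresh index [k] lets independence be applied to the family over [k :: J]. *)
  pose f' i := if i == k then B else f i.
  have -> : X `&` B = \bigcap_(i in [set` k :: J]) f' i.
    rewrite XE; apply/seteqP; split=> [w [fw Bw] j /=|w fw].
      rewrite in_cons /f'; case: eqP => //= _; exact: fw.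
    split=> [j jJ|]; last by have := fw k (mem_head _ _); rewrite /f' eqxx.
    have := fw j; rewrite /= in_cons jJ orbT /f' => /(_ erefl).
    by case: eqP => // jk; move: kJ; rewrite -jk jJ.
  rewrite indF/= ?kJ//; last first.
    by move=> i _; rewrite /f'; case: eqP => [->|].
  rewrite big_cons /f' eqxx muleC indX; congr (_ * _)%E.
  rewrite big_seq [RHS]big_seq; apply: eq_bigr => i iJ; case: eqP => // ik.
  by move: kJ; rewrite -ik iJ.
- by move=> _ /=; rewrite /mrestr setTI ltey_eq fin_num_measure.
Qed.

(** Independence makes the joint law a product, so by Fubini the probability is the integral, over
    the law of [U], of the mass that [V] gives to the sections of [E]. These have mass at most [c]
    over [D] and are empty elsewhere. *)
Lemma indep_pair_le (R : realType) (dO d1 d2 : measure_display)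
    (Omega : measurableType dO) (T1 : measurableType d1)
    (T2 : measurableType d2) (P : probability Omega R)
    (U : {RV P >-> T1}) (V : {RV P >-> T2}) :
  (forall A B, measurable A -> measurable B ->
     P (U @^-1` A `&` V @^-1` B) = (P (U @^-1` A) * P (V @^-1` B))%E) ->
  forall (E : set (T1 * T2)) (D : set T1) (c : R),
    measurable E -> measurable D -> (E `<=` D `*` setT) ->
    (forall u, D u -> (distribution P V (xsection E u) <= c%:E)%E) -> 0 <= c ->
  (P [set w | E (U w, V w)] <= c%:E * P (U @^-1` D))%E.
Proof.
move=> ind E D c mE mD ED Ec c0.
have mUV : measurable_fun setT (fun w => (U w, V w)).
  exact: measurable_fun_pair.
pose UV : {mfun Omega >-> (T1 * T2)%type} := mfun_Sub (mem_set mUV).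
have -> : P [set w | E (U w, V w)] = distribution P UV E by [].
have UVE A B : measurable A -> measurable B ->
    distribution P UV (A `*` B) = (distribution P U A * distribution P V B)%E.
  by move=> mA mB; rewrite -ind.
have <- := product_measure_unique UVE mE.
rewrite /product_measure1 /= (_ : P (U @^-1` D) = distribution P U D)//.
rewrite -(setIT D) -integral_indic// -ge0_integralZl//; last first.
- by apply/measurable_EFinP; exact: measurable_indic.
apply: ge0_le_integral => //=.
- exact: measurable_fun_xsection.
- by apply: measurable_funeM; apply/measurable_EFinP; exact: measurable_indic.
move=> u _; rewrite indicE; have [/set_mem Du|/negP uD] := boolP (u \in D).
  rewrite mule1; exact: Ec.
rewrite mule0 (_ : xsection E u = set0) ?measure0//.
apply/seteqP; split => // z; rewrite /xsection /= inE => Euz; apply: uD.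
by rewrite inE; case: (ED _ Euz).
Qed.

(** * Measurability of matrix operations *)

Lemma measurable_sqrt (R : realType) : measurable_fun [set: R] (@Num.sqrt R).
Proof. by apply: continuous_measurable_fun; exact: sqrt_continuous. Qed.

Lemma measurable_invr (R : realType) : measurable_fun [set: R] (@GRing.inv R).
Proof.
(* Inversion is continuous on the open set of nonzero reals; the point 0 is treated apart. *)
rewrite (_ : [set: R] = [set x | x != 0] `|` [set 0]); last first.
  apply/seteqP; split=> // x _; have [->|x0] := eqVneq x 0; first by right.
  by left.
apply/measurable_funU.
- by apply: open_measurable; exact: open_neq.
- exact: measurable_set1.
split; last exact: measurable_fun_set1.
apply: open_continuous_measurable_fun; first exact: open_neq.
by move=> x /set_mem x0; exact: inv_continuous.
Qed.

Lemma measurable_mx_entry (d dW : measure_display) (T : measurableType d)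
    (W : measurableType dW) (m n : nat) (i : 'I_m) (j : 'I_n)
    (f : W -> 'M[T]_(m, n)) :
  measurable_fun setT f -> measurable_fun setT (fun w => f w i j).
Proof.
move=> mf; apply: (measurableT_comp (f := fun M : 'M[T]_(m, n) => M i j)) => //.
move=> _ A mA; apply: sub_sigma_algebra.
by exists (i, j) => //; exists A.
Qed.

Lemma measurable_mxP (d dW : measure_display) (T : measurableType d)
    (W : measurableType dW) (m n : nat) (f : W -> 'M[T]_(m, n)) :
  (forall i j, measurable_fun setT (fun w => f w i j)) ->
  measurable_fun setT f.
Proof.
move=> mf; apply: (@measurability _ _ _ _ _ _ (matrix_entry_preimages)) => //.
move=> _ [_ [[i j] _ [B mB <-]] <-]; rewrite !setTI.
by rewrite -[X in measurable X]setTI; exact: mf.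
Qed.

Lemma measurable_mulmx (R : realType) (dW : measure_display)
    (W : measurableType dW) (m n p : nat) (f : W -> 'M[R]_(m, n))
    (h : W -> 'M[R]_(n, p)) :
  measurable_fun setT f -> measurable_fun setT h ->
  measurable_fun setT (fun w => f w *m h w).
Proof.
move=> mf mh; apply: measurable_mxP => i j.
under eq_fun do rewrite mxE.
apply: measurable_sum => k; apply: measurable_funM.
  exact: measurable_mx_entry.
exact: measurable_mx_entry.
Qed.

Lemma measurable_trmx (R : realType) (dW : measure_display)
    (W : measurableType dW) (m n : nat) (f : W -> 'M[R]_(m, n)) :
  measurable_fun setT f -> measurable_fun setT (fun w => (f w)^T).
Proof.
move=> mf; apply: measurable_mxP => i j; under eq_fun do rewrite mxE.
exact: measurable_mx_entry.
Qed.

Lemma measurable_scalemx (R : realType) (dW : measure_display)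
    (W : measurableType dW) (m n : nat) (c : W -> R) (f : W -> 'M[R]_(m, n)) :
  measurable_fun setT c -> measurable_fun setT f ->
  measurable_fun setT (fun w => c w *: f w).
Proof.
move=> mc mf; apply: measurable_mxP => i j; under eq_fun do rewrite mxE.
apply: measurable_funM => //.
exact: measurable_mx_entry.
Qed.

Lemma measurable_submx (R : realType) (dW : measure_display)
    (W : measurableType dW) (m n : nat) (f h : W -> 'M[R]_(m, n)) :
  measurable_fun setT f -> measurable_fun setT h ->
  measurable_fun setT (fun w => f w - h w).
Proof.
move=> mf mh; apply: measurable_mxP => i j; under eq_fun do rewrite !mxE.
apply: measurable_funB.
  exact: measurable_mx_entry.
exact: measurable_mx_entry.
Qed.

Lemma measurable_qform (R : realType) (dW : measure_display)
    (W : measurableType dW) (d : nat) (A : 'M[R]_d) (f : W -> 'cV[R]_d) :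
  measurable_fun setT f -> measurable_fun setT (fun w => qform A (f w)).
Proof.
move=> mf; apply: measurable_mx_entry.
apply: measurable_mulmx => //; apply: measurable_mulmx => //.
exact: measurable_trmx.
Qed.

Lemma measurable_mxnorm (R : realType) (dW : measure_display)
    (W : measurableType dW) (d : nat) (A : 'M[R]_d) (f : W -> 'cV[R]_d) :
  measurable_fun setT f -> measurable_fun setT (fun w => mxnorm A (f w)).
Proof.
move=> mf; apply: (measurableT_comp (@measurable_sqrt R)).
exact: measurable_qform.
Qed.

Lemma measurable_dotv (R : realType) (dW : measure_display)
    (W : measurableType dW) (d : nat) (f h : W -> 'cV[R]_d) :
  measurable_fun setT f -> measurable_fun setT h ->
  measurable_fun setT (fun w => dotv (f w) (h w)).
Proof.
move=> mf mh; apply: measurable_mx_entry.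
by apply: measurable_mulmx => //; exact: measurable_trmx.
Qed.

Lemma measurable_normalize (R : realType) (dW : measure_display)
    (W : measurableType dW) (d : nat) (f : W -> 'cV[R]_d) :
  measurable_fun setT f -> measurable_fun setT (fun w => normalize (f w)).
Proof.
move=> mf; apply: measurable_scalemx => //.
apply: (measurableT_comp (@measurable_invr R)).
apply: (measurableT_comp (@measurable_sqrt R)).
exact: measurable_dotv.
Qed.

(** Only the seeds before [t] are assumed measurable and [W] is arbitrary, so that the lemma also
    applies to [Omega] with the sigma-algebra generated by [g] and those seeds. *)
Lemma measurable_iterates (R : realType) (d : nat)
    (dX dW : measure_display) (Xi : measurableType dX)
    (W : measurableType dW) (solve : 'cV[R]_d -> Xi -> 'cV[R]_d)
    (g : W -> 'cV[R]_d) (xi : nat -> W -> Xi) (t : nat) :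
  measurable_fun [set: 'cV[R]_d * Xi] (fun p => solve p.1 p.2) ->
  measurable_fun setT g ->
  (forall s, (s < t)%N -> measurable_fun setT (xi s)) ->
  measurable_fun setT (iterates solve g xi t).
Proof.
move=> msolve mg; elim: t => [|t IH] mxi /=; first exact: measurable_normalize.
apply: measurable_normalize.
apply: (measurableT_comp (f := fun p : 'cV[R]_d * Xi => solve p.1 p.2)
  (g := fun w => (iterates solve g xi t w, xi t w))) => //.
apply: measurable_fun_pair; last exact: mxi.
by apply: IH => s st; apply: mxi; rewrite ltnS ltnW.
Qed.

(** * Independence of the seeds from the past, and escape probabilities *)

(** The pair is measurable for the sigma-algebra of the start and the seeds before [t], a group
    independent of [xi t]. Keeping [g] beside the iterate allows events to be restricted by their
    starting point. *)
Lemma fresh_seeds_indep (R : realType) (d : nat)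
    (dO dX : measure_display) (Omega : measurableType dO)
    (Xi : measurableType dX) (P : probability Omega R) (Q : probability Xi R)
    (solve : 'cV[R]_d -> Xi -> 'cV[R]_d) (g : {RV P >-> 'cV[R]_d})
    (xi : nat -> {RV P >-> Xi}) (t : nat) :
  measurable_fun [set: 'cV[R]_d * Xi] (fun p => solve p.1 p.2) ->
  fresh_seeds g Q xi ->
  forall (A : set ('cV[R]_d * 'cV[R]_d)) (B : set Xi),
    measurable A -> measurable B ->
    let U w := (g w, iterates solve g (fun s => xi s) t w) in
    P (U @^-1` A `&` xi t @^-1` B) = (P (U @^-1` A) * P (xi t @^-1` B))%E.
Proof.
move=> msolve [_ ind] A B mA mB U.
pose F (o : option nat) : set (set Omega) :=
  if o is Some s then g_sigma_algebra_preimage (xi s)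
  else g_sigma_algebra_preimage g.
pose J := None :: [seq Some s | s <- iota 0 t].
have Fpre o : exists dY (Y : measurableType dY) (f : {mfun Omega >-> Y}),
    F o = preimage_set_system setT f measurable.
  case: o => [s|]; first by exists dX, Xi, (xi s).
  by exists _, _, g.
apply: (@mutually_independent_group _ _ _ P _ F J (Some t)) => //.
- move=> o X; have [dY [Y [f ->]]] := Fpre o.
  by move=> [C mC <-]; rewrite setTI -[X in measurable X]setTI; exact: measurable_funP.
- move=> o; have [dY [Y [f ->]]] := Fpre o.
  by exists setT => //; rewrite preimage_setT setIT.
- move=> o X1 X2; have [dY [Y [f ->]]] := Fpre o.
  move=> [C1 mC1 <-] [C2 mC2 <-]; exists (C1 `&` C2); first exact: measurableI.
  by rewrite !setTI preimage_setI.
- rewrite /J /= map_inj_uniq ?iota_uniq ?andbT; last by move=> ? ? [].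
  by apply/negP => /mapP[].
- rewrite /J in_cons /=; apply/negP => /mapP[s].
  by rewrite mem_iota add0n /= => st [ts]; move: st; rewrite ts ltnn.
- pose G := \bigcup_(o in [set` J]) F o.
  (* [W] is [Omega] with the coarser sigma-algebra of the start and the past seeds. *)
  pose W := g_sigma_algebraType G.
  have FW o : o \in J -> F o `<=` <<s G >>.
    by move=> oJ X FX; apply: sub_sigma_algebra; exists o.
  have mg : measurable_fun [set: W] (g : W -> _).
    by move=> _ C mC; apply: (FW None); rewrite ?mem_head//; exists C.
  have mxi s : (s < t)%N -> measurable_fun [set: W] (xi s : W -> _).
    move=> st _ C mC; apply: (FW (Some s)); last by exists C.
    by rewrite in_cons /= map_f// mem_iota.
  have mU : measurable_fun [set: W] (U : W -> _).
    apply: measurable_fun_pair => //.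
    by apply: (@measurable_iterates _ _ _ _ _ W).
  by rewrite -[X in <<s _ >> X]setTI; exact: mU.
- by exists B => //; rewrite setTI.
Qed.

(** Induction on [t]: a bad run at time [t.+1] is either bad at time [t], or has [x_t] in [S t] and
    draws a bad seed [xi t], which is independent of the past. The factor [P (g @^-1] makes rare
    starts cheap even when their escape rates are large. *)
Lemma iterates_escape (R : realType) (d : nat)
    (dO dX : measure_display) (Omega : measurableType dO)
    (Xi : measurableType dX) (P : probability Omega R) (Q : probability Xi R)
    (solve : 'cV[R]_d -> Xi -> 'cV[R]_d) (g : {RV P >-> 'cV[R]_d})
    (xi : nat -> {RV P >-> Xi}) (A : set 'cV[R]_d) (S : nat -> set 'cV[R]_d)
    (rho : nat -> R) :
  measurable_fun [set: 'cV[R]_d * Xi] (fun p => solve p.1 p.2) ->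
  fresh_seeds g Q xi ->
  measurable A -> (forall t, measurable (S t)) -> (forall t, 0 <= rho t) ->
  (forall x, A x -> S 0%N (normalize x)) ->
  (forall t x, S t x ->
     (Q [set s | ~ S t.+1 (normalize (solve x s))] <= (rho t)%:E)%E) ->
  forall t,
    (P [set w | A (g w) /\ ~ S t (iterates solve g (fun s => xi s) t w)] <=
     (\sum_(i < t) rho i)%:E * P (g @^-1` A))%E.
Proof.
move=> msolve fresh mA mS rho0 AS Srho.
have mX t : measurable_fun setT (iterates solve g (fun s => xi s) t).
  by apply: measurable_iterates.
have mbad t : measurable
    [set w | A (g w) /\ ~ S t (iterates solve g (fun s => xi s) t w)].
  apply: measurableI.
    by rewrite -[X in measurable X]setTI; exact: measurable_funP.
  by apply: measurableC; rewrite -[X in measurable X]setTI; exact: mX.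
elim=> [|t IH].
  rewrite (_ : [set w | _] = set0) ?measure0 ?big_ord0 ?mul0e//.
  by apply/seteqP; split => // w [Aw]; case; exact: AS.
pose X := iterates solve g (fun s => xi s) t.
have mU : measurable_fun setT (fun w => (g w, X w)).
  apply: measurable_fun_pair; last exact: mX.
  exact: measurable_funP.
pose U : {mfun Omega >-> ('cV[R]_d * 'cV[R]_d)%type} := mfun_Sub (mem_set mU).
pose D : set ('cV[R]_d * 'cV[R]_d) := [set u | A u.1 /\ S t u.2].
pose E : set (('cV[R]_d * 'cV[R]_d) * Xi) :=
  [set p | D p.1 /\ ~ S t.+1 (normalize (solve p.1.2 p.2))].
have mD : measurable D.
  by rewrite (_ : D = A `*` S t)//; exact: measurableX.
have mE : measurable E.
  rewrite (_ : E = fst @^-1` D `&`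
    ~` ((fun p => normalize (solve p.1.2 p.2)) @^-1` S t.+1))//.
  apply: measurableI.
    by rewrite -[X in measurable X]setTI; exact: measurable_fst.
  apply: measurableC; rewrite -[X in measurable X]setTI.
  apply: measurable_normalize => //.
  apply: (measurableT_comp (f := fun p : 'cV[R]_d * Xi => solve p.1 p.2)
    (g := fun p : ('cV[R]_d * 'cV[R]_d) * Xi => (p.1.2, p.2))) => //.
  apply: measurable_fun_pair; last exact: measurable_snd.
  exact: (measurableT_comp measurable_snd measurable_fst).
have step : (P [set w | E (U w, xi t w)] <= (rho t)%:E * P (U @^-1` D))%E.
  apply: indep_pair_le => //.
  - move=> C B mC mB; exact: (fresh_seeds_indep t msolve fresh mC mB).
  - by move=> p [].
  - move=> u Du; rewrite fresh.1; last exact: measurable_xsection.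
    have -> : xsection E u = [set s | ~ S t.+1 (normalize (solve u.2 s))].
      by apply/seteqP; split=> s; rewrite /xsection /= inE => // -[].
    exact: Srho Du.2.
have sub : [set w | A (g w) /\ ~ S t.+1 (iterates solve g (fun s => xi s) t.+1 w)]
    `<=` [set w | A (g w) /\ ~ S t (X w)] `|` [set w | E (U w, xi t w)].
  move=> w [Aw nS]; have [St|nSt] := pselect (S t (X w)); last by left.
  by right.
have mEw : measurable [set w | E (U w, xi t w)].
  have mUxi : measurable_fun setT (fun w => (U w, xi t w)).
    by apply: measurable_fun_pair; exact: measurable_funP.
  by rewrite -[X in measurable X]setTI; exact: mUxi.
apply: le_trans (le_measure P _ _ sub) _.
- by rewrite inE; exact: mbad.
- by rewrite inE; apply: measurableU => //; exact: mbad.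
apply: le_trans (measureU2 P (mbad t) mEw) _.
rewrite big_ord_recr /= EFinD ge0_muleDl ?lee_fin ?sumr_ge0//.
apply: leeD; first exact: IH.
(* Membership in [D] includes the start lying in [A], so the mass of [D] is at most that of [A]. *)
apply: le_trans step _; apply: lee_pmul => //; first by rewrite lee_fin.
apply: le_measure; rewrite ?inE; last by move=> w [].
  by rewrite -[X in measurable X]setTI; apply: (mU measurableT).
by rewrite -[X in measurable X]setTI; exact: measurable_funP.
Qed.

(** * Gaussian vectors *)

Lemma normal_peak1_le1 (R : realType) : normal_peak (1 : R) <= 1.
Proof.
have pi2 := @pi_ge2 R; rewrite /normal_peak expr1n mul1r.
have p1 : 1 <= Num.sqrt (pi *+ 2 : R) by rewrite -[leLHS]sqrtr1 ler_wsqrtr//; lra.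
by rewrite invf_le1// (lt_le_trans _ p1).
Qed.

(** The density never exceeds its peak, which is at most 1, so the length of the interval is a
    bound. *)
Lemma normal_prob_ball_le (R : realType) (a r : R) : 0 <= r ->
  (normal_prob 0 1 (`](a - r)%R, (a + r)%R[%classic : set R) <= (r *+ 2)%:E)%E.
Proof.
move=> r0; rewrite /normal_prob.
apply: (@le_trans _ _
  (\int[lebesgue_measure]_(x in `](a - r)%R, (a + r)%R[) (cst 1%:E x))%E).
  apply: ge0_le_integral => //=.
  - by move=> x _; rewrite lee_fin normal_pdf_ge0.
  - apply/measurable_EFinP; apply: measurable_funTS.
    exact: measurable_normal_pdf.
  - move=> x _; rewrite lee_fin (le_trans (normal_pdf_ub _ _ _))//.
    exact: normal_peak1_le1.
rewrite integral_cst//= mul1e lebesgue_measure_itv/= lte_fin.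
case: ifP => _; last by rewrite lee_fin mulrn_wge0.
by rewrite -EFinB lee_fin; lra.
Qed.

(* On |x| > s the density of N(0, 1) is at most sqrt 2 * exp (- s^2 / 4) times
   the density of N(0, 2). *)
Lemma normal_prob_tail (R : realType) (s : R) : 0 <= s ->
  (normal_prob 0 1 [set x : R | (s < `|x|)%R] <=
   (Num.sqrt 2 * expR (- (s ^+ 2 / 4)))%:E)%E.
Proof.
move=> s0; rewrite /normal_prob.
have mA : measurable [set x : R | s < `|x|].
  rewrite -[X in measurable X]setTI.
  apply: measurable_fun_ltr => //.
have sq2 : Num.sqrt 2 != 0 :> R by rewrite gt_eqF// sqrtr_gt0.
set c := (X in (_ <= X%:E)%E).
have c0 : 0 <= c by rewrite mulr_ge0 ?expR_ge0.
apply: (@le_trans _ _ (\int[lebesgue_measure]_(x in [set x : R | (s < `|x|)%R])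
    (c%:E * (normal_pdf 0 (Num.sqrt 2) x)%:E))%E).
  apply: ge0_le_integral => //=.
  - by move=> x _; rewrite lee_fin normal_pdf_ge0.
  - apply/measurable_EFinP; apply: measurable_funTS.
    exact: measurable_normal_pdf.
  - apply: measurable_funeM; apply/measurable_EFinP; apply: measurable_funTS.
    exact: measurable_normal_pdf.
  - move=> x /= sx; rewrite lee_fin !normal_pdfE//.
    rewrite /normal_peak /normal_fun sqr_sqrtr// expr1n mul1r subr0.
    have -> : 2 * pi *+ 2 = 2 * (pi *+ 2) :> R by rewrite -mulrnAr.
    rewrite sqrtrM// invfM.
    have -> : c * ((Num.sqrt 2)^-1 / Num.sqrt (pi *+ 2) *
        expR (- x ^+ 2 / (2 *+ 2))) = (Num.sqrt (pi *+ 2))^-1 *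
        (expR (- (s ^+ 2 / 4)) * expR (- x ^+ 2 / (2 *+ 2))).
      by rewrite /c -!mulrA mulrCA [RHS]mulrCA; congr (_ * _); rewrite mulVKf.
    rewrite ler_wpM2l// -expRD ler_expR.
    have : s ^+ 2 <= x ^+ 2.
      by rewrite -(real_normK (num_real x)) lerXn2r ?nnegrE// ltW.
    lra.
rewrite ge0_integralZl//=; last 2 first.
- by apply/measurable_EFinP; apply: measurable_funTS; exact: measurable_normal_pdf.
- by move=> x _; rewrite lee_fin normal_pdf_ge0.
rewrite -[leRHS]mule1 lee_pmul ?lee_fin//.
  by apply: integral_ge0 => x _; rewrite lee_fin normal_pdf_ge0.
exact: (probability_le1 (normal_prob 0 (Num.sqrt 2)) mA).
Qed.

Lemma std_gaussian_indep (R : realType) (d : nat) (dO : measure_display)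
    (Omega : measurableType dO) (P : probability Omega R)
    (g : {RV P >-> 'cV[R]_d}) (v : 'cV[R]_d) (j : 'I_d) :
  std_gaussian g ->
  forall A B : set R, measurable A -> measurable B ->
    let U w := \sum_(i < d | i != j) v i 0 * g w i 0 in
    P (U @^-1` A `&` (fun w => g w j 0) @^-1` B) =
    (P (U @^-1` A) * P ((fun w => g w j 0%R) @^-1` B))%E.
Proof.
move=> [ind _] A B mA mB U.
pose F (i : 'I_d) : set (set Omega) :=
  g_sigma_algebra_preimage (fun w => g w i 0 : R).
pose J := [seq i <- enum 'I_d | i != j].
have mg i : measurable_fun setT (fun w => g w i 0 : R).
  by apply: measurable_mx_entry; exact: measurable_funP.
apply: (@mutually_independent_group _ _ _ P _ F J j) => //.
- move=> i X [C mC <-]; rewrite setTI -[X in measurable X]setTI; exact: mg.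
- by move=> i; exists setT => //; rewrite preimage_setT setIT.
- move=> i X1 X2 [C1 mC1 <-] [C2 mC2 <-]; exists (C1 `&` C2).
    exact: measurableI.
  by rewrite !setTI preimage_setI.
- by rewrite filter_uniq// enum_uniq.
- by rewrite mem_filter eqxx.
- pose G := \bigcup_(i in [set` J]) F i.
  pose W := g_sigma_algebraType G.
  have mU : measurable_fun [set: W] (U : W -> R).
    (* The redundant test [i \in J] makes every summand measurable for the small sigma-algebra,
       whatever [i] is. *)
    rewrite (_ : (U : W -> R) = (fun w => \sum_(i <- J)
        (if i \in J then v i 0 * g w i 0 else 0))); last first.
      apply/funext => w; rewrite -big_mkcond -big_seq /U /J big_filter.
      by rewrite big_enum_cond; apply: eq_bigl => i.
    apply: measurable_sum => i; have [iJ|_] := boolP (i \in J); last first.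
      exact: measurable_cst.
    apply: measurable_funM => //.
    move=> _ C mC; apply: sub_sigma_algebra; exists i => //.
    by exists C.
  by rewrite -[X in <<s _ >> X]setTI; exact: mU.
- by exists B => //; rewrite setTI.
Qed.

Lemma dotvE (R : realType) (d : nat) (x y : 'cV[R]_d) :
  dotv x y = \sum_(i < d) x i 0 * y i 0.
Proof. by rewrite /dotv mxE; apply: eq_bigr => i _; rewrite mxE. Qed.

(** With the other coordinates fixed, the event confines coordinate [j] to an interval of radius
    [delta / |v_j|]. Choosing [j] with [|v_j| >= 1/d] bounds its probability by [2 d delta]. *)
Lemma std_gaussian_small_ball (R : realType) (d : nat) (dO : measure_display)
    (Omega : measurableType dO) (P : probability Omega R)
    (g : {RV P >-> 'cV[R]_d}) (v : 'cV[R]_d) (delta : R) :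
  std_gaussian g -> dotv v v = 1 -> 0 <= delta ->
  (P [set w | (`|dotv v (g w)| < delta)%R] <= (2 * d%:R * delta)%:E)%E.
Proof.
move=> gauss vv delta0.
have d0 : (0 < d)%N.
  by case: (d) v vv => // v; rewrite /dotv mxE big_ord0 => /eqP; rewrite eq_sym oner_eq0.
have dR : 1 <= d%:R :> R by rewrite ler1n.
(* The squares sum to 1, so they cannot all be below the average [1/d]. *)
have [j vj] : exists j, (d%:R)^-1 <= (v j 0) ^+ 2.
  apply: contrapT => /forallNP vlt.
  have : \sum_(i < d) v i 0 * v i 0 < \sum_(i < d) (d%:R : R)^-1.
    apply: ltr_sum => [|i _].
      by apply/hasP; exists (Ordinal d0); rewrite ?mem_index_enum.
    by rewrite -expr2 ltNge; apply/negP; exact: vlt.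
  rewrite -dotvE vv.
  by rewrite sumr_const card_ord -[_ *+ d]mulr_natr mulVf ?ltxx// gt_eqF// (lt_le_trans _ dR).
(* The available bound [d^(-1/2)] is weakened to [1/d] to stay with integer powers. *)
have vj1 : d%:R^-1 <= `|v j 0|.
  rewrite -(@ler_sqr _ _ `|_|) ?nnegrE ?invr_ge0// real_normK ?num_real//.
  apply: le_trans vj; rewrite exprVn lef_pV2 ?posrE ?exprn_gt0 ?(lt_le_trans _ dR)//.
  by rewrite expr2 ler_peMl// (le_trans _ dR).
have vj0 : 0 < `|v j 0| by rewrite (lt_le_trans _ vj1)// invr_gt0 (lt_le_trans _ dR).
pose U w := \sum_(i < d | i != j) v i 0 * g w i 0.
have mgj : measurable_fun setT (fun w => g w j 0 : R).
  by apply: measurable_mx_entry; exact: measurable_funP.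
have mU : measurable_fun setT U.
  rewrite /U; under eq_fun do rewrite big_mkcond.
  apply: measurable_sum => i; have [_|_] := boolP (i != j); last first.
    exact: measurable_cst.
  apply: measurable_funM => //.
  by apply: measurable_mx_entry; exact: measurable_funP.
pose U' : {mfun Omega >-> R} := mfun_Sub (mem_set mU).
pose V' : {mfun Omega >-> R} := mfun_Sub (mem_set mgj).
pose E := [set p : R * R | `|p.1 + v j 0 * p.2| < delta].
have mE : measurable E.
  rewrite -[X in measurable X]setTI; apply: measurable_fun_ltr => //.
  apply: measurableT_comp => //; apply: measurable_funD => //.
  exact: measurable_funM.
rewrite (_ : [set w | _] = [set w | E (U' w, V' w)]); last first.
  apply/seteqP; split => w /=; rewrite /E /= dotvE (bigD1 j)//= addrC //.
(* The section bound is uniform, so [D] is taken to be the whole line. *)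
rewrite -[leRHS]mule1 -(@probability_setT _ _ _ P) -(preimage_setT U').
apply: (@indep_pair_le _ _ _ _ _ _ _ _ U' V') => //; last 1 first.
- by rewrite !mulr_ge0.
- move=> A B mA mB; exact: (std_gaussian_indep v j gauss mA mB).
- move=> u _.
  have -> : xsection E u =
      `](- u / v j 0 - delta / `|v j 0|), (- u / v j 0 + delta / `|v j 0|)[%classic.
    have key x : (`|u + v j 0 * x| < delta) =
        (x \in `](- u / v j 0 - delta / `|v j 0|), (- u / v j 0 + delta / `|v j 0|)[).
      rewrite in_itv /= -ltr_distl ltr_pdivlMr// -normrM mulrBl.
      by rewrite divfK -?normr_gt0// opprK addrC mulrC.
    apply/seteqP; split=> x; rewrite /xsection /E /=.
      by rewrite inE /= key.
    by move=> ux; apply: mem_set; rewrite /= key.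
  rewrite [X in (X <= _)%E](_ : _ = normal_prob 0 1 (`](- u / v j 0 - delta / `|v j 0|)%R,
      (- u / v j 0 + delta / `|v j 0|)%R[%classic : set R)); last first.
    by case: gauss => _ gP; apply: (gP j).
  apply: le_trans (normal_prob_ball_le _ _) _; first by rewrite divr_ge0// ltW.
  rewrite lee_fin -mulrA -[leLHS]mulr_natl ler_wpM2l// mulrC ler_wpM2r//.
  by rewrite -[leRHS]invrK lef_pV2 ?posrE ?invr_gt0// (lt_le_trans _ dR).
Qed.

Lemma std_gaussian_tail (R : realType) (d : nat) (dO : measure_display)
    (Omega : measurableType dO) (P : probability Omega R)
    (g : {RV P >-> 'cV[R]_d}) (s : R) :
  std_gaussian g -> 0 <= s ->
  (P [set w | exists i : 'I_d, (s < `|g w i 0|)%R] <=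
   (d%:R * (Num.sqrt 2 * expR (- (s ^+ 2 / 4))))%:E)%E.
Proof.
move=> gauss s0.
have mg i : measurable_fun setT (fun w => g w i 0 : R).
  by apply: measurable_mx_entry; exact: measurable_funP.
have mA : measurable [set x : R | s < `|x|].
  by rewrite -[X in measurable X]setTI; apply: measurable_fun_ltr => //.
pose c := Num.sqrt 2 * expR (- (s ^+ 2 / 4)) : R.
pose A i := [set w | s < `|g w i 0|%R].
have mAi i : measurable (A i).
  by rewrite -[X in measurable X]setTI; exact: (mg i measurableT _ mA).
have mU (r : seq 'I_d) : measurable [set w | exists2 i, i \in r & A i w].
  rewrite (_ : [set w | _] = \bigcup_(i in [set` r]) A i)//.
  exact: fin_bigcup_measurable.
(* Union bound over the coordinates, one at a time along a list. *)
have main (r : seq 'I_d) :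
    (P [set w | exists2 i, i \in r & A i w] <= ((size r)%:R * c)%:E)%E.
  elim: r => [|i r IH].
    rewrite (_ : [set w | _] = set0) ?measure0 ?mul0r//.
    by apply/seteqP; split=> // w [].
  have -> : [set w | exists2 j, j \in i :: r & A j w] =
      A i `|` [set w | exists2 j, j \in r & A j w].
    apply/seteqP; split=> w /=.
      move=> [j]; rewrite in_cons => /orP[/eqP-> Aw|jr Aw]; first by left.
      by right; exists j.
    move=> [Aw|[j jr Aw]]; first by exists i; rewrite ?mem_head.
    by exists j => //; rewrite in_cons jr orbT.
  apply: le_trans (measureU2 P (mAi i) (mU r)) _.
  have -> : (size (i :: r))%:R * c = c + (size r)%:R * c.
    by rewrite /= -natr1 mulrDl mul1r addrC.
  rewrite EFinD; apply: leeD; last exact: IH.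
  by case: gauss => _ gP; rewrite [X in (X <= _)%E](gP i _ mA); exact: normal_prob_tail.
have := main (enum 'I_d); rewrite size_enum_ord; congr (P _ <= _)%E.
by apply/seteqP; split=> w /= [i]; [exists i|exists i; rewrite ?mem_enum].
Qed.

(** * Spectral coordinates *)

Section spectral.
Variables (R : realType) (d : nat).
Implicit Types (x y e : 'cV[R]_d).

Lemma dotvBr x y e : dotv x (y - e) = dotv x y - dotv x e.
Proof. by rewrite /dotv mulmxBr !mxE. Qed.

Lemma dotvZr x a y : dotv x (a *: y) = a * dotv x y.
Proof. by rewrite /dotv -scalemxAr mxE. Qed.

Lemma norm2_normalize x : x != 0 -> norm2 (normalize x) = 1.
Proof.
move=> x0; have xx : 0 < dotv x x.
  have [i xi] : exists i, x i 0 != 0.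
    apply/existsP; apply: contraNT x0; rewrite negb_exists => /forallP x0.
    by apply/eqP/colP => i; rewrite mxE; apply/eqP; move: (x0 i); rewrite negbK.
  rewrite dotvE (bigD1 i)//= ltr_pwDl ?sumr_ge0//.
    by rewrite -expr2 exprn_even_gt0.
  by move=> j _; rewrite -expr2 sqr_ge0.
rewrite {1}/norm2 /normalize dotvZr /dotv linearZ /= -scalemxAl mxE -/(dotv x x).
by rewrite mulrA -expr2 exprVn sqr_sqrtr ?ltW// mulVf ?sqrtr1// gt_eqF.
Qed.

(** Unique factorization determines the roots up to permutation and sorting fixes their order, so
    the choice made by [xget] is forced. *)
Lemma eigenvalues_unique (A : 'M[R]_d) (s : seq R) :
  sorted >=%R s -> char_poly A = \prod_(a <- s) ('X - a%:P) ->
  eigenvalues A = s.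
Proof.
move=> s_sorted sA; rewrite /eigenvalues; case: xgetP => [t _ [t_sorted tA]|/(_ s)[]//].
apply: (sorted_eq (@ge_trans _ _)) => //; first exact: ge_anti.
by apply: prod_XsubC_eq; rewrite -tA -sA.
Qed.

Section diagonal.
Variables (Sigma : 'M[R]_d) (lam : 'I_d -> R) (v : 'I_d -> 'cV[R]_d).
Variable lambda : R.
Hypothesis eig : eigensystem Sigma lam v.
Hypothesis lam_lt : forall i, lam i < lambda.

Let B : 'M[R]_d := lambda%:M - Sigma.
Let b i := lambda - lam i.
(** The eigenvectors are the columns of [V], an orthogonal matrix. *)
Let V : 'M[R]_d := \matrix_(i, j) v j i 0.

Let b_gt0 i : 0 < b i. Proof. by rewrite subr_gt0. Qed.
Let b_neq0 i : b i != 0. Proof. by rewrite gt_eqF. Qed.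

Let VTV : V^T *m V = 1%:M.
Proof.
have [_ orth _] := eig.
apply/matrixP => i j; rewrite !mxE -orth dotvE.
by apply: eq_bigr => k _; rewrite !mxE.
Qed.

Let VVT : V *m V^T = 1%:M. Proof. exact: mulmx1C. Qed.

Let VTE x i : (V^T *m x) i 0 = dotv (v i) x.
Proof. by rewrite dotvE mxE; apply: eq_bigr => k _; rewrite !mxE. Qed.

(** Parseval's identity in the eigenbasis, from [V *m V^T = 1]. *)
Lemma dotv_eig x y : dotv x y = \sum_i dotv (v i) x * dotv (v i) y.
Proof.
have -> : dotv x y = ((V^T *m x)^T *m (V^T *m y)) 0 0.
  by rewrite trmx_mul trmxK mulmxA -[_ *m V *m V^T]mulmxA VVT mulmx1.
by rewrite mxE; apply: eq_bigr => i _; rewrite [in LHS]mxE !VTE.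
Qed.

(** The matrix with eigenvectors [v i] and eigenvalues [a i]; both [B] and its inverse have this
    form. *)
Let Vdiag (a : 'I_d -> R) : 'M[R]_d := V *m diag_mx (\row_i a i) *m V^T.

Let dotv_Vdiag a x i : dotv (v i) (Vdiag a *m x) = a i * dotv (v i) x.
Proof.
by rewrite -!VTE /Vdiag !mulmxA VTV mul1mx -mulmxA mul_diag_mx !mxE.
Qed.

Let shiftE : B = Vdiag b.
Proof.
have [ev _ _] := eig.
have BV : B *m V = V *m diag_mx (\row_i b i).
  apply/matrixP => i j; rewrite /B mulmxBl mul_scalar_mx mul_mx_diag !mxE.
  have /(congr1 (fun M : 'cV[R]_d => M i 0)) := ev j; rewrite !mxE => evj.
  rewrite /b mulrBr [v j i 0 * lambda]mulrC; congr (_ - _).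
  by rewrite mulrC -evj; apply: eq_bigr => k _; rewrite !mxE.
by rewrite /Vdiag -BV -mulmxA VVT mulmx1.
Qed.

Let invE : invmx B = Vdiag (fun i => (b i)^-1).
Proof.
(* The candidate is checked to be a right inverse, which for square matrices also yields
   invertibility. *)
have BW : B *m Vdiag (fun i => (b i)^-1) = 1%:M.
  rewrite shiftE /Vdiag -!mulmxA [V^T *m _]mulmxA VTV mul1mx.
  rewrite [diag_mx _ *m (diag_mx _ *m _)]mulmxA mulmx_diag.
  rewrite (_ : diag_mx _ = 1%:M) ?mul1mx//.
  apply/matrixP => i j; rewrite !mxE; case: eqP => // ->.
  by rewrite mulfV.
have [uB _] := mulmx1_unit BW.
by rewrite -[RHS]mul1mx -(mulVmx uB) -mulmxA BW mulmx1.
Qed.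

Lemma dotv_invmx_shift x i :
  dotv (v i) (invmx B *m x) = (lambda - lam i)^-1 * dotv (v i) x.
Proof. by rewrite invE dotv_Vdiag. Qed.

Lemma qform_shift x :
  qform B x = \sum_i (lambda - lam i) * dotv (v i) x ^+ 2.
Proof.
have -> : qform B x = dotv x (B *m x) by rewrite /qform /dotv mulmxA.
rewrite dotv_eig; apply: eq_bigr => i _.
by rewrite shiftE dotv_Vdiag mulrCA expr2.
Qed.

(** Hence the multiplier of [x] in the residual is the inverse of its [B]-energy, which is the
    optimal multiplier. *)
Lemma quot_shift x : norm2 x = 1 -> lambda - quot Sigma x = qform B x.
Proof.
move=> x1.
have xx : dotv x x = 1.
  by rewrite -[LHS]sqr_sqrtr ?sqrtr_ge0// -/(norm2 x) ?x1 ?expr1n// dotvE sumr_ge0// => i _; rewrite -expr2 sqr_ge0.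
rewrite /quot xx divr1 /qform /B mulmxBr mulmxBl mul_mx_scalar -scalemxAl.
have xx' : (x^T *m x) 0 0 = 1 := xx.
by rewrite [RHS]mxE [in X in _ = X + _]mxE xx' mulr1 [in X in _ = _ + X]mxE.
Qed.

(** Conjugation by the orthogonal [V], lifted to polynomial matrices, reduces the determinant to a
    diagonal one. *)
Lemma char_poly_invmx_shift :
  char_poly (invmx B) = \prod_(i < d) ('X - ((lambda - lam i)^-1)%:P).
Proof.
pose D := diag_mx (\row_i (lambda - lam i)^-1) : 'M[R]_d.
have polyV : map_mx polyC V *m map_mx polyC V^T = 1%:M.
  by rewrite -map_mxM VVT map_mx1.
rewrite /char_poly; have -> : char_poly_mx (invmx B) =
    map_mx polyC V *m char_poly_mx D *m map_mx polyC V^T.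
  rewrite /char_poly_mx invE /Vdiag !map_mxM mulmxBr mulmxBl; congr (_ - _).
  by rewrite mul_mx_scalar -scalemxAl polyV scalemx1.
rewrite !det_mulmx mulrAC -det_mulmx polyV det1 mul1r.
rewrite -[LHS]/(char_poly D) char_poly_trig ?diag_mx_is_trig//.
by apply: eq_bigr => i _; rewrite !mxE eqxx.
Qed.

(** As [lam] is nonincreasing, the gaps [lambda - lam i] are nondecreasing and positive, so their
    inverses already come in sorted order. *)
Lemma eigenvalues_invmx_shift :
  eigenvalues (invmx B) = [seq (lambda - lam i)^-1 | i <- enum 'I_d].
Proof.
have [_ _ lam_mono] := eig.
apply: eigenvalues_unique; last first.
  by rewrite char_poly_invmx_shift big_map big_enum.
rewrite sorted_map; apply: (@sub_sorted _ (relpre val ltn)).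
  move=> i j /= ij; have bij : lambda - lam i <= lambda - lam j.
    by apply: lerB => //; apply: lam_mono; exact: ltnW.
  by rewrite /= lef_pV2 ?posrE ?subr_gt0.
by rewrite -sorted_map val_enum_ord iota_ltn_sorted.
Qed.

Lemma cond_invmx_shift (i1 il : 'I_d) : i1 = 0%N :> nat -> il = d.-1 :> nat ->
  cond (invmx B) = (lambda - lam il) / (lambda - lam i1).
Proof.
move=> i10 ild; rewrite /cond /eigenval eigenvalues_invmx_shift.
have nthE (k : 'I_d) :
    nth 0 [seq (lambda - lam i)^-1 | i <- enum 'I_d] k = (lambda - lam k)^-1.
  by rewrite (nth_map k) ?size_enum_ord// nth_ord_enum.
by have := nthE i1; have := nthE il; rewrite i10 ild => -> ->; rewrite invrK mulrC.
Qed.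

End diagonal.
End spectral.

(** * One step of the iteration *)

(** Here [c] and [e] are the coordinates of [x] and of the error of [solve], and [y] those of its
    output. The error hypothesis compares with one eighth of the [B]-norm of the first component of
    [B^-1 x]; the other components of [B^-1 x] are damped by the factor 101. *)
Lemma power_step_coords (R : realType) (d : nat) (i1 : 'I_d)
    (b c e : 'I_d -> R) (tau : R) :
  (forall i, 0 < b i) -> (forall i, i != i1 -> 101 * b i1 <= b i) ->
  0 <= tau -> c i1 != 0 ->
  \sum_(i | i != i1) b i * c i ^+ 2 <= tau * (b i1 * c i1 ^+ 2) ->
  \sum_i b i * e i ^+ 2 <= c i1 ^+ 2 / (64 * b i1) ->
  let y i := (b i)^-1 * c i + e i in
  y i1 != 0 /\
  \sum_(i | i != i1) b i * y i ^+ 2 <= (tau / 16 + 2 / 49) * (b i1 * y i1 ^+ 2).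
Proof.
move=> b0 gap tau0 c10 small_rest small y.
pose k := c i1 / b i1; have b1 := b0 i1.
have k2 : k ^+ 2 = c i1 ^+ 2 / b i1 ^+ 2 by rewrite /k expr_div_n.
have k2b : b i1 * k ^+ 2 = c i1 ^+ 2 / b i1 by rewrite k2; field; rewrite gt_eqF.
have k20 : 0 < k ^+ 2 by rewrite exprn_even_gt0//= mulf_neq0// invr_neq0// gt_eqF.
have ebound : \sum_i b i * e i ^+ 2 <= b i1 * k ^+ 2 / 64.
  by apply: le_trans small _; rewrite k2b invfM [_^-1 * _]mulrC mulrA.
have e1 : e i1 ^+ 2 <= k ^+ 2 / 64.
  rewrite -(ler_pM2l b1) [leRHS]mulrA; apply: le_trans ebound.
  rewrite [leRHS](bigD1 i1)//= lerDl.
  by apply: sumr_ge0 => i _; rewrite mulr_ge0 ?sqr_ge0// ltW.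
have y1E : y i1 = k + e i1 by rewrite /y /k mulrC.
(* From [|e_1| <= |k| / 8], [|y_1| >= 7/8 |k|]. *)
have y1 : 49 / 64 * k ^+ 2 <= y i1 ^+ 2.
  have : `|e i1| <= `|k| / 8.
    rewrite -(@ler_pXn2r _ 2) ?nnegrE ?divr_ge0//.
    by rewrite expr_div_n !real_normK ?num_real//; lra.
  have [kp|kn] := leP 0 k; rewrite y1E => /ler_normlP[]; [rewrite ger0_norm//|rewrite ltr0_norm//]; nra.
split.
  by rewrite -sqrf_eq0 gt_eqF// (lt_le_trans _ y1)// mulr_gt0.
(* Uses [(u + z)^2 <= 2 u^2 + 2 z^2] and [b_i >= 101 b_1]. *)
have split_sq i : i != i1 -> b i * y i ^+ 2 <=
    2 / (101 * b i1) ^+ 2 * (b i * c i ^+ 2) + 2 * (b i * e i ^+ 2).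
  move=> ii1; have bi := b0 i; have gi := gap i ii1.
  have inv_le : (b i)^-1 ^+ 2 <= ((101 * b i1) ^+ 2)^-1.
    by rewrite exprVn lef_pV2 ?posrE ?exprn_gt0 ?mulr_gt0// lerXn2r ?nnegrE ?mulr_ge0// ltW.
  have : y i ^+ 2 <= 2 * ((b i)^-1 ^+ 2 * c i ^+ 2) + 2 * e i ^+ 2.
    rewrite -exprMn /y; move: ((b i)^-1 * c i) (e i) => u z.
    by have := sqr_ge0 (u - z); nra.
  move=> yi; move: inv_le; set w := ((101 * b i1) ^+ 2)^-1 => inv_le.
  have -> : 2 * w * (b i * c i ^+ 2) + 2 * (b i * e i ^+ 2) =
    b i * (2 * (w * c i ^+ 2) + 2 * e i ^+ 2) by ring.
  rewrite ler_pM2l//; apply: le_trans yi _.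
  by rewrite lerD2r ler_pM2l// ler_wpM2r ?sqr_ge0.
apply: le_trans (ler_sum _ split_sq) _.
rewrite big_split /= -!mulr_sumr.
have e2 : \sum_(i | i != i1) b i * e i ^+ 2 <= b i1 * k ^+ 2 / 64.
  apply: le_trans ebound; rewrite [leRHS](bigD1 i1)//= lerDr.
  by rewrite mulr_ge0 ?sqr_ge0// ltW.
have c2 : 2 / (101 * b i1) ^+ 2 * (\sum_(i | i != i1) b i * c i ^+ 2) <=
    2 / 101 ^+ 2 * (tau * (b i1 * k ^+ 2)).
  apply: (@le_trans _ _ (2 / (101 * b i1) ^+ 2 * (tau * (b i1 * c i1 ^+ 2)))).
    by rewrite ler_wpM2l// divr_ge0// sqr_ge0.
  rewrite le_eqVlt; apply/orP; left; apply/eqP; rewrite k2; field.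
  by rewrite gt_eqF.
have by1 : 49 / 64 * (b i1 * k ^+ 2) <= b i1 * y i1 ^+ 2.
  by rewrite mulrCA ler_pM2l.
(* After division by 49/64 the error part [2/64] gives [2/49], and [2/101^2] gives a coefficient
   well below [1/16]. *)
set Y := b i1 * y i1 ^+ 2 in by1 *.
set K := b i1 * k ^+ 2 in e2 c2 by1.
have K0 : 0 <= K by rewrite mulr_ge0 ?ltW.
have tY : tau * (49 / 64 * K) <= tau * Y by rewrite ler_wpM2l.
have tK : 0 <= tau * K by rewrite mulr_ge0.
nra.
Qed.

(* 1 / beta minimizes alpha |-> sum_i b_i (alpha c_i - c_i / b_i)^2; compare with
   alpha = 1 / b_1. *)
Lemma rayleigh_residual_coords (R : realType) (d : nat) (i1 : 'I_d)
    (b c : 'I_d -> R) (beta : R) :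
  (forall i, 0 < b i) -> (forall i, b i1 <= b i) -> \sum_i c i ^+ 2 = 1 ->
  beta = \sum_i b i * c i ^+ 2 ->
  \sum_i b i * (beta^-1 * c i - (b i)^-1 * c i) ^+ 2 <=
  (\sum_(i | i != i1) b i * c i ^+ 2) / b i1 ^+ 2.
Proof.
move=> b0 bmin c1 betaE; have b1 := b0 i1.
have quad alpha : \sum_i b i * (alpha * c i - (b i)^-1 * c i) ^+ 2 =
    alpha ^+ 2 * beta - 2 * alpha + \sum_i (b i)^-1 * c i ^+ 2.
  have -> : 2 * alpha = \sum_i 2 * alpha * c i ^+ 2.
    by rewrite -mulr_sumr c1 mulr1.
  rewrite betaE mulr_sumr -sumrB -big_split /=.
  by apply: eq_bigr => i _; field; rewrite gt_eqF.
have beta0 : 0 < beta.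
  rewrite (lt_le_trans b1)// betaE -[leLHS]mulr1 -c1 mulr_sumr ler_sum// => i _.
  by rewrite ler_wpM2r ?sqr_ge0.
apply: (@le_trans _ _ (\sum_i b i * ((b i1)^-1 * c i - (b i)^-1 * c i) ^+ 2)).
  rewrite !quad lerD2r -subr_ge0.
  rewrite (_ : _ - _ = beta * ((b i1)^-1 - beta^-1) ^+ 2); last first.
    by field; rewrite !gt_eqF.
  by rewrite mulr_ge0 ?sqr_ge0// ltW.
(* With [alpha = 1 / b_1] the first term vanishes; elsewhere [0 <= 1/b_1 - 1/b_i <= 1/b_1]. *)
rewrite (bigD1 i1)//= subrr expr0n mulr0 add0r mulr_suml ler_sum// => i _.
have bi := b0 i; rewrite -mulrBl exprMn mulrCA [leRHS]mulrC ler_wpM2r//.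
  by rewrite mulr_ge0 ?sqr_ge0// ltW.
have inv_le : (b i)^-1 <= (b i1)^-1 by rewrite lef_pV2 ?posrE.
have bi0 : 0 <= (b i)^-1 by rewrite invr_ge0 ltW.
by rewrite -exprVn lerXn2r ?nnegrE ?subr_ge0 ?gerBl// (le_trans bi0).
Qed.

Lemma markov_lt (R : realType) (dX : measure_display) (Xi : measurableType dX)
    (Q : probability Xi R) (f : Xi -> R) (a C : R) :
  measurable_fun setT f -> (forall s, 0 <= f s) -> 0 < a ->
  ('E_Q[f] <= C%:E)%E -> (Q [set s | (a < f s)%R] <= (C / a)%:E)%E.
Proof.
move=> mf f0 a0 Ef; pose X : {mfun Xi >-> R} := mfun_Sub (mem_set mf).
have mark := @markov _ _ _ Q X id a a0 (@measurable_id _ _ _) (fun r => id) _.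
have {mark} : (a%:E * Q [set s | a%:E <= `|(X s)%:E|] <= C%:E)%E.
  apply: le_trans (mark _) _; first by move=> x y.
  apply: le_trans Ef; rewrite le_eqVlt; apply/orP; left; apply/eqP.
  by congr expectation; apply/funext => s /=; rewrite ger0_norm.
move=> mark; rewrite EFinM lee_pdivlMr// muleC; apply: le_trans mark.
apply: lee_pmul => //; first by rewrite lee_fin ltW.
apply: le_measure; rewrite ?inE.
- rewrite -[X in measurable X]setTI; exact: measurable_fun_ltr.
- rewrite (_ : [set s | _] = [set s | a <= `|X s|]).
    rewrite -[X in measurable X]setTI; apply: measurable_fun_ler => //.
    exact: measurableT_comp.
  by apply/seteqP; split=> s /=; rewrite lee_fin.
- by move=> s /= afs; rewrite lee_fin ger0_norm// ltW.
Qed.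

Section cone.
Variables (R : realType) (d : nat) (i1 : 'I_d).
Variables (v : 'I_d -> 'cV[R]_d) (b : 'I_d -> R).

(* Unit vectors x with G(x)^2 <= tau, where b lists the eigenvalues of B. *)
Definition cone (tau : R) : set 'cV[R]_d :=
  [set x | [/\ norm2 x = 1, dotv (v i1) x != 0 &
    \sum_(i | i != i1) b i * dotv (v i) x ^+ 2 <=
      tau * (b i1 * dotv (v i1) x ^+ 2)]].

Lemma cone_monotone tau tau' : 0 <= b i1 -> tau <= tau' ->
  cone tau `<=` cone tau'.
Proof.
move=> b1 tt x [x1 x0 le]; split=> //; apply: le_trans le _.
by rewrite ler_wpM2r// mulr_ge0// sqr_ge0.
Qed.

(** Both sides of the inequality are homogeneous of degree two, and a nonzero first coordinate
    excludes the zero vector. *)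
Lemma cone_normalize tau y : dotv (v i1) y != 0 ->
  \sum_(i | i != i1) b i * dotv (v i) y ^+ 2 <=
    tau * (b i1 * dotv (v i1) y ^+ 2) ->
  cone tau (normalize y).
Proof.
move=> y0 le; have ny0 : y != 0.
  by apply: contra_neq y0 => ->; rewrite /dotv mulmx0 mxE.
have n0 : (norm2 y)^-1 != 0.
  apply: contra_eq_neq (norm2_normalize ny0) => /eqP.
  rewrite /normalize => /eqP ->; rewrite scale0r /norm2 /dotv mulmx0 mxE sqrtr0.
  by rewrite eq_sym oner_neq0.
split; first exact: norm2_normalize.
  by rewrite dotvZr mulf_neq0.
under eq_bigr do rewrite dotvZr exprMn mulrCA.
rewrite -mulr_sumr dotvZr exprMn mulrCA [b i1 * _]mulrCA mulrCA.
by rewrite [leRHS](_ : _ = (norm2 y)^-1 ^+ 2 * (tau * (b i1 * dotv (v i1) y ^+ 2))) ?ler_wpM2l ?sqr_ge0//; ring.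
Qed.

Lemma measurable_cone tau : measurable (cone tau).
Proof.
have mdot i : measurable_fun setT (fun x : 'cV[R]_d => dotv (v i) x).
  by apply: measurable_dotv.
rewrite (_ : cone tau = norm2 @^-1` [set 1] `&`
  (dotv (v i1) @^-1` (~` [set 0]) `&`
   [set x | \sum_(i < d) (if i != i1 then b i * dotv (v i) x ^+ 2 else 0) <=
      tau * (b i1 * dotv (v i1) x ^+ 2)])); last first.
  apply/seteqP; split=> x /=.
    by case=> x1 /eqP x0 le; rewrite -big_mkcond.
  by rewrite -big_mkcond => -[x1 [/eqP x0 le]].
apply: measurableI.
  rewrite -[X in measurable X]setTI.
  apply: (measurableT_comp (@measurable_sqrt R)) => //.
  exact: measurable_dotv.
apply: measurableI.
  rewrite -[X in measurable X]setTI; apply: mdot => //.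
  by apply: measurableC.
rewrite -[X in measurable X]setTI; apply: measurable_fun_ler => //.
  apply: measurable_sum => i; have [_|_] := boolP (i != i1); last first.
    exact: measurable_cst.
  by apply: measurable_funM => //; apply: measurable_funX.
apply: measurable_funM => //; apply: measurable_funM => //.
exact: measurable_funX.
Qed.

End cone.

Section step.
Variables (R : realType) (d : nat) (i1 : 'I_d) (Sigma : 'M[R]_d).
Variables (lam : 'I_d -> R) (v : 'I_d -> 'cV[R]_d) (lambda : R).
Hypothesis eig : eigensystem Sigma lam v.
Hypothesis lam_lt : forall i, lam i < lambda.
Hypothesis gap :
  forall i, i != i1 -> 101 * (lambda - lam i1) <= lambda - lam i.

Let B : 'M[R]_d := lambda%:M - Sigma.
Let b i := lambda - lam i.
Let b_gt0 i : 0 < b i. Proof. by rewrite subr_gt0. Qed.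

Lemma cone_step tau x y : 0 <= tau -> cone i1 v b tau x ->
  mxnorm B (y - invmx B *m x) <=
    `|dotv (v i1) x| / (8 * Num.sqrt (b i1)) ->
  cone i1 v b (tau / 16 + 2 / 49) (normalize y).
Proof.
move=> tau0 [x1 x0 le] small; set e := y - invmx B *m x in small.
have yE i : dotv (v i) y = (b i)^-1 * dotv (v i) x + dotv (v i) e.
  by rewrite dotvBr (dotv_invmx_shift eig lam_lt) addrC subrK.
have qe0 : 0 <= qform B e.
  rewrite (qform_shift lambda eig) sumr_ge0// => i _.
  by rewrite mulr_ge0 ?sqr_ge0// ltW// b_gt0.
have [|y0 yle] := @power_step_coords _ _ i1 b (fun i => dotv (v i) x)
    (fun i => dotv (v i) e) tau b_gt0 gap tau0 x0 le.
  rewrite -(qform_shift lambda eig) -[leLHS]sqr_sqrtr//.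
  have -> : dotv (v i1) x ^+ 2 / (64 * b i1) =
      (`|dotv (v i1) x| / (8 * Num.sqrt (b i1))) ^+ 2.
    rewrite expr_div_n real_normK ?num_real// exprMn sqr_sqrtr ?(ltW (b_gt0 _))//.
    by congr (_ / (_ * _)); ring.
  rewrite lerXn2r ?nnegrE ?sqrtr_ge0// divr_ge0// mulr_ge0//.
apply: cone_normalize; first by rewrite yE.
rewrite yE; under eq_bigr do rewrite yE.
exact: yle.
Qed.

(** Inside the cone the expected error is at most [eps * sqrt tau] times the [B]-norm of the first
    component of [B^-1 x]. Markov at one eighth of that norm gives the bound, since [x] cancels;
    below this threshold [cone_step] applies. *)
Lemma cone_escape (dX : measure_display) (Xi : measurableType dX)
    (Q : probability Xi R) (solve : 'cV[R]_d -> Xi -> 'cV[R]_d) (eps tau : R) :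
  measurable_fun [set: 'cV[R]_d * Xi] (fun p => solve p.1 p.2) -> 0 <= eps ->
  (forall x : 'cV[R]_d, norm2 x = 1 ->
    ('E_Q[fun s => mxnorm B (solve x s - invmx B *m x)] <=
      (eps *
       mxnorm B ((lambda - quot Sigma x)^-1 *: x - invmx B *m x))%:E)%E) ->
  0 <= tau -> forall x, cone i1 v b tau x ->
  (Q [set s | ~ cone i1 v b (tau / 16 + 2 / 49) (normalize (solve x s))] <=
    (8 * eps * Num.sqrt tau)%:E)%E.
Proof.
move=> msolve eps0 Esolve tau0 x cx; have [x1 x0 le] := cx.
have b1 := b_gt0 i1; have sb1 : 0 < Num.sqrt (b i1) by rewrite sqrtr_gt0.
have msx : measurable_fun setT (fun s => solve x s).
  exact: (measurable_fun_pair2 x msolve).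
have mf : measurable_fun setT
    (fun s => mxnorm B (solve x s - invmx B *m x)).
  apply: measurable_mxnorm; apply: measurable_submx; first exact: msx.
  exact: measurable_cst.
pose a := `|dotv (v i1) x| / (8 * Num.sqrt (b i1)).
have a0 : 0 < a by rewrite divr_gt0 ?normr_gt0// mulr_gt0.
have xx : dotv x x = 1.
  rewrite -[LHS]sqr_sqrtr -/(norm2 x) ?x1 ?expr1n// dotvE sumr_ge0// => i _.
  by rewrite -expr2 sqr_ge0.
have resid : mxnorm B ((lambda - quot Sigma x)^-1 *: x - invmx B *m x) <=
    Num.sqrt tau * (Num.sqrt (b i1) * `|dotv (v i1) x|) / b i1.
  rewrite -[leRHS]ger0_norm; last first.
    by rewrite !mulr_ge0 ?invr_ge0 ?sqrtr_ge0 ?normr_ge0 ?(ltW b1).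
  rewrite -sqrtr_sqr; apply: ler_wsqrtr.
  rewrite (qform_shift lambda eig) (quot_shift Sigma lambda x1).
  under eq_bigr do rewrite dotvBr dotvZr (dotv_invmx_shift eig lam_lt).
  apply: le_trans (@rayleigh_residual_coords _ _ i1 b
    (fun i => dotv (v i) x) _ b_gt0 _ _ _) _.
  - move=> i; have [->//|/gap] := eqVneq i i1; move: b1; rewrite /b; lra.
  - by rewrite -xx (dotv_eig eig); apply: eq_bigr => i _; rewrite expr2.
  - exact: (qform_shift lambda eig).
  rewrite expr_div_n ler_wpM2r ?invr_ge0 ?sqr_ge0// !exprMn.
  by rewrite !sqr_sqrtr ?(ltW b1)// real_normK ?num_real.
apply: (@le_trans _ _ (Q [set s | (a < mxnorm B (solve x s - invmx B *m x))%R])).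
  apply: le_measure; rewrite ?inE.
  - apply: measurableC; rewrite -[X in measurable X]setTI.
    by apply: measurable_normalize => //; exact: measurable_cone.
  - rewrite -[X in measurable X]setTI; exact: measurable_fun_ltr.
  - move=> s /= nc; rewrite ltNge; apply/negP => small; apply: nc.
    exact: cone_step small.
apply: le_trans (markov_lt mf _ a0 (Esolve x x1)) _.
  by move=> s; exact: sqrtr_ge0.
rewrite lee_fin ler_pdivrMr//.
have -> : 8 * eps * Num.sqrt tau * a =
    eps * (Num.sqrt tau * (Num.sqrt (b i1) * `|dotv (v i1) x|) / b i1).
  have sE : b i1 = Num.sqrt (b i1) ^+ 2 by rewrite sqr_sqrtr// ltW.
  rewrite /a; move: sb1 sE; move: (Num.sqrt (b i1)) => r r0 ->.
  by field; rewrite gt_eqF.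
by rewrite ler_wpM2l.
Qed.

End step.

(** * Convergence *)

Section convergence.
Variables (R : realType) (d : nat) (i1 : 'I_d) (Sigma : 'M[R]_d).
Variables (lam : 'I_d -> R) (v : 'I_d -> 'cV[R]_d) (lambda : R).
Hypothesis eig : eigensystem Sigma lam v.
Hypothesis lam_lt : forall i, lam i < lambda.
Hypothesis gap :
  forall i, i != i1 -> 101 * (lambda - lam i1) <= lambda - lam i.

Let B : 'M[R]_d := lambda%:M - Sigma.
Let b i := lambda - lam i.
Let b_gt0 i : 0 < b i. Proof. by rewrite subr_gt0. Qed.

(** The box gives [|x|^2 <= d s^2], every [b i] is at most [kappa * b i1], and the first coordinate
    is at least [delta] in absolute value. *)
Lemma cone_init (kappa s delta : R) (x : 'cV[R]_d) : (forall i, b i <= kappa * b i1) ->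
  (forall j, `|x j 0| <= s) -> 0 < delta -> delta <= `|dotv (v i1) x| ->
  cone i1 v b (kappa * (d%:R * s ^+ 2) / delta ^+ 2) (normalize x).
Proof.
move=> bk xs delta0 zge; have b1 := b_gt0 i1.
have z0 : 0 < `|dotv (v i1) x| by exact: lt_le_trans zge.
have s0 : 0 <= s by exact: le_trans (xs i1).
have k0 : 0 <= kappa.
  by rewrite -(pmulr_lge0 _ b1) (le_trans _ (bk i1))// ltW.
apply: cone_normalize; first by rewrite -normr_gt0.
apply: (@le_trans _ _ (kappa * b i1 * (d%:R * s ^+ 2))).
  apply: (@le_trans _ _ (kappa * b i1 * dotv x x)).
    rewrite (dotv_eig eig) mulr_sumr [leRHS](bigD1 i1)//=.
    rewrite ler_wpDl//; first by rewrite -expr2 mulr_ge0 ?sqr_ge0// mulr_ge0// ltW.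
    by apply: ler_sum => i _; rewrite -expr2 ler_wpM2r ?sqr_ge0.
  rewrite ler_wpM2l//; first by rewrite mulr_ge0// ltW.
  rewrite dotvE -[d in leRHS]card_ord mulr_natl -sumr_const ler_sum// => j _.
  by rewrite -expr2 -(real_normK (num_real (x j 0))) lerXn2r ?nnegrE.
have -> : kappa * (d%:R * s ^+ 2) / delta ^+ 2 * (b i1 * dotv (v i1) x ^+ 2) =
    kappa * b i1 * (d%:R * s ^+ 2) * (dotv (v i1) x ^+ 2 / delta ^+ 2) by ring.
rewrite ler_peMr//; first by rewrite !mulr_ge0 ?(ltW b1) ?sqr_ge0.
rewrite ler_pdivlMr ?exprn_gt0// mul1r -(real_normK (num_real (dotv _ x))).
by rewrite lerXn2r ?nnegrE// ltW.
Qed.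

(** In the eigenbasis the two projections keep and drop coordinate [i1], so [G^2] is the quotient of
    the two sums compared in [cone]. *)
Lemma G_le_cone (tau : R) (y : 'cV[R]_d) : 0 <= tau -> norm2 y = 1 ->
  (dotv (v i1) y != 0 /\ G B (v i1) y <= Num.sqrt tau) <-> cone i1 v b tau y.
Proof.
move=> tau0 y1; have [_ orth _] := eig; have b1 := b_gt0 i1.
have cP i : dotv (v i) (Pspan (v i1) *m y) =
    if i == i1 then dotv (v i1) y else 0.
  rewrite /Pspan orth eqxx invr1 scale1r -mulmxA.
  rewrite [(v i1)^T *m y](_ : _ = (dotv (v i1) y)%:M); last first.
    by apply/matrixP => j k; rewrite !ord1 [RHS]mxE eqxx.
  rewrite mul_mx_scalar dotvZr orth.
  by case: eqP => _; rewrite ?mulr1 ?mulr0.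
have GE : dotv (v i1) y != 0 -> G B (v i1) y = Num.sqrt
   ((\sum_(i | i != i1) b i * dotv (v i) y ^+ 2) / (b i1 * dotv (v i1) y ^+ 2)).
  move=> y0; rewrite /G /mxnorm !(qform_shift lambda eig).
  have -> : \sum_i (lambda - lam i) * dotv (v i) (Pspan (v i1) *m y) ^+ 2 =
      b i1 * dotv (v i1) y ^+ 2.
    rewrite (bigD1 i1)//= cP eqxx big1 ?addr0// => i /negPf ii1.
    by rewrite cP ii1 expr0n mulr0.
  have -> : \sum_i (lambda - lam i) * dotv (v i) (Pperp (v i1) *m y) ^+ 2 =
      \sum_(i | i != i1) b i * dotv (v i) y ^+ 2.
    rewrite (bigD1 i1)//= /Pperp mulmxBl mul1mx dotvBr cP eqxx subrr expr0n mulr0.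
    by rewrite add0r; apply: eq_bigr => i /negPf ii1; rewrite dotvBr cP ii1 subr0.
  have W0 : 0 <= b i1 * dotv (v i1) y ^+ 2 by rewrite mulr_ge0 ?sqr_ge0// ltW.
  rewrite [RHS]sqrtrM ?sqrtrV// sumr_ge0// => i _.
  by rewrite mulr_ge0 ?sqr_ge0// ltW// b_gt0.
split.
  move=> [y0]; rewrite GE// ler_sqrt// ler_pdivrMr; first by split.
  by rewrite mulr_gt0// exprn_even_gt0.
move=> [_ y0 le]; split=> //; rewrite GE// ler_sqrt// ler_pdivrMr//.
by rewrite mulr_gt0// exprn_even_gt0.
Qed.

(** The widths [tau t] dominate the recursion [tau / 16 + 2 / 49], and the escape rates
    [8 eps sqrt (tau t)] sum to a geometric part, at most [16 eps M], plus [2 eps] per step. *)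
Lemma cone_iterates_escape (dO dX : measure_display)
    (Omega : measurableType dO) (Xi : measurableType dX)
    (P : probability Omega R) (Q : probability Xi R)
    (solve : 'cV[R]_d -> Xi -> 'cV[R]_d) (g : {RV P >-> 'cV[R]_d})
    (xi : nat -> {RV P >-> Xi}) (eps M : R) (A : set 'cV[R]_d) (T : nat) :
  measurable_fun [set: 'cV[R]_d * Xi] (fun p => solve p.1 p.2) -> 0 <= eps ->
  (forall x : 'cV[R]_d, norm2 x = 1 ->
    ('E_Q[fun s => mxnorm B (solve x s - invmx B *m x)] <=
      (eps *
       mxnorm B ((lambda - quot Sigma x)^-1 *: x - invmx B *m x))%:E)%E) ->
  fresh_seeds g Q xi -> 0 <= M -> measurable A ->
  (forall x, A x -> cone i1 v b (M ^+ 2) (normalize x)) ->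
  (P [set w | A (g w) /\ ~ cone i1 v b (M ^+ 2 / 4 ^+ T + 1 / 20)
                (iterates solve g (fun s => xi s) T w)] <=
   (eps * (16 * M + 2 * T%:R))%:E * P (g @^-1` A))%E.
Proof.
move=> msolve eps0 Esolve fresh M0 mA AS.
pose tau t : R := M ^+ 2 / 4 ^+ t + 1 / 20.
pose rho t : R := 8 * eps * (M / 2 ^+ t + 1 / 4).
have p4 t : 0 < (4 : R) ^+ t by rewrite exprn_gt0.
have p2 t : 0 < (2 : R) ^+ t by rewrite exprn_gt0.
have tau0 t : 0 <= tau t by rewrite addr_ge0 ?divr_ge0 ?sqr_ge0// ltW.
have rho0 t : 0 <= rho t.
  by rewrite mulr_ge0 ?mulr_ge0// addr_ge0// divr_ge0// ltW.
(* The constant works because [1/20 <= 1/16]. *)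
have sqrt_tau t : Num.sqrt (tau t) <= M / 2 ^+ t + 1 / 4.
  have Mt : 0 <= M / 2 ^+ t by rewrite divr_ge0// ltW.
  rewrite -[leRHS]ger0_norm ?addr_ge0// -sqrtr_sqr ler_wsqrtr//.
  have e4 : (2 : R) ^+ 2 = 4 by ring.
  have -> : tau t = (M / 2 ^+ t) ^+ 2 + 1 / 20.
    by rewrite expr_div_n exprAC e4.
  by move: (M / 2 ^+ t) Mt => m m0; nra.
apply: le_trans (@iterates_escape _ _ _ _ _ _ P Q solve g xi A
  (fun t => cone i1 v b (tau t)) rho msolve fresh mA _ rho0 _ _ T) _.
- by move=> t; exact: measurable_cone.
- move=> x Ax; apply: cone_monotone (AS x Ax); first exact: ltW.
  by rewrite /tau expr0 divr1 lerDl.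
- move=> t x cx.
  have msx : measurable_fun setT (fun s => normalize (solve x s)).
    apply: measurable_normalize.
    exact: (measurable_fun_pair2 x msolve).
  have mc r : measurable [set s | ~ cone i1 v b r (normalize (solve x s))].
    apply: measurableC; rewrite -[X in measurable X]setTI.
    by apply: msx => //; exact: measurable_cone.
  apply: (@le_trans _ _
    (Q [set s | ~ cone i1 v b (tau t / 16 + 2 / 49) (normalize (solve x s))])).
    apply: le_measure; rewrite ?inE; [exact: mc|exact: mc|].
    move=> s /=; apply: contra_not; apply: cone_monotone; first exact: ltW.
    (* The fixed part closes up since [1/320 + 2/49 <= 1/20]. *)
    rewrite /tau [4 ^+ t.+1]exprS invfM; have : 0 <= M ^+ 2 / 4 ^+ t.
      by rewrite divr_ge0 ?sqr_ge0// ltW.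
    move: (4 ^+ t)^-1 => q; set m := M ^+ 2; nra.
  apply: le_trans (cone_escape eig lam_lt gap msolve eps0 Esolve (tau0 t) cx) _.
  by rewrite lee_fin ler_wpM2l ?mulr_ge0.
apply: lee_pmul => //; first by rewrite lee_fin sumr_ge0.
rewrite lee_fin; apply: (@le_trans _ _
    (eps * (16 * M * (1 - (2 ^+ T)^-1) + 2 * T%:R))); last first.
  by rewrite ler_wpM2l// lerD2r ler_piMr ?mulr_ge0// gerBl invr_ge0.
rewrite le_eqVlt; apply/orP; left; apply/eqP.
elim: T => [|T IH]; first by rewrite big_ord0 expr0 invr1 subrr !mulr0 addr0 mulr0.
rewrite big_ord_recr /= IH /rho -natr1 exprS; have := p2 T.
by move: (2 ^+ T) => q q0; field; rewrite gt_eqF.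
Qed.

End convergence.

(** * Numerical estimates *)

Section constants.
Variable R : realType.

(** From [1 + x <= exp x] at [-1/2], inverted and squared. It turns a lower bound on [T] into one on
    [4^T]. *)
Lemma expR1_le4 : expR 1 <= 4 :> R.
Proof.
have h : 1 / 2 <= expR (- (1 / 2)) :> R.
  by apply: le_trans (expR_ge1Dx _); lra.
have e2 : expR (1 / 2) <= 2 :> R.
  rewrite -[expR _]invrK -expRN -[leRHS]invrK lef_pV2 ?posrE ?expR_gt0//.
  by apply: le_trans h; lra.
have -> : 1 = 1 / 2 + 1 / 2 :> R by lra.
rewrite expRD; have := expR_ge0 (1 / 2 : R).
by move: (expR (1 / 2)) e2 => e e2 e0; nra.
Qed.

Lemma iteration_count_large (D kappa : R) (T : nat) :
  2 <= D -> 1 <= kappa -> 40 * (ln D + ln kappa) <= T%:R ->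
  (kappa * D ^+ 14) ^+ 2 / 4 ^+ T <= 1 / 20.
Proof.
move=> D2 k1 leT; have D0 : 0 < D by lra.
have k0 : 0 < kappa by lra.
have pow : (kappa * D) ^+ 40 <= 4 ^+ T.
  apply: (@le_trans _ _ (expR 1 ^+ T)); last first.
    by apply: lerXn2r; rewrite ?nnegrE ?expR_ge0 ?expR1_le4.
  rewrite -[expR 1 ^+ T]expRM_natl mulr1.
  apply: (@le_trans _ _ (expR (40 * (ln D + ln kappa)))); last by rewrite ler_expR.
  by rewrite expRM_natl expRD !lnK ?posrE// mulrC.
have p4 : 0 < (4 : R) ^+ T by rewrite exprn_gt0.
rewrite ler_pdivrMr//.
suff : 20 * (kappa * D ^+ 14) ^+ 2 <= 4 ^+ T.
  by move: (4 ^+ T) ((kappa * D ^+ 14) ^+ 2) => q m; lra.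
apply: le_trans pow.
(* Since [4^T >= (kappa D)^40] and only [D^28] is needed, the spare [D^12] absorbs the factor 20. *)
have D12 : 20 <= D ^+ 12.
  apply: (@le_trans _ _ (2 ^+ 12)); first by rewrite -natrX ler_nat.
  by rewrite lerXn2r ?nnegrE// ltW.
have -> : (kappa * D) ^+ 40 =
    D ^+ 12 * ((kappa * D ^+ 14) ^+ 2 * kappa ^+ 38) by ring.
apply: ler_pM => //; first by rewrite sqr_ge0.
by rewrite ler_peMr ?sqr_ge0// exprn_ege1.
Qed.

(** With [y = D^4 / 12] the exponential is [exp (- 3 y) <= y^-3 = 12^3 / D^12], and [12^3 = 1728];
    the factor [2 D] costs one power of [D] and the 2 is absorbed by [D >= 2]. *)
Lemma gaussian_tail_constant (D : R) : 2 <= D ->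
  D * (Num.sqrt 2 * expR (- ((D ^+ 2) ^+ 2 / 4))) <= 1728 / D ^+ 10.
Proof.
move=> D2; have D0 : 0 < D by lra.
have s2 : Num.sqrt 2 <= 2 :> R.
  rewrite -[leRHS]ger0_norm// -sqrtr_sqr ler_wsqrtr//.
  by rewrite expr2; lra.
pose y := D ^+ 4 / 12.
have y0 : 0 < y by rewrite divr_gt0 ?exprn_gt0.
have le_e : expR (- ((D ^+ 2) ^+ 2 / 4)) <= (y ^+ 3)^-1.
  have -> : - ((D ^+ 2) ^+ 2 / 4) = - (3 * y) by rewrite /y; field.
  rewrite expRN lef_pV2 ?posrE ?expR_gt0 ?exprn_gt0//.
  rewrite expRM_natl lerXn2r ?nnegrE ?expR_ge0 ?(ltW y0)//.
  by apply: le_trans (expR_ge1Dx _); lra.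
apply: (@le_trans _ _ (D * (2 * (y ^+ 3)^-1))).
  by rewrite ler_pM2l// ler_pM// expR_ge0.
have -> : D * (2 * (y ^+ 3)^-1) = 3456 / D * (D ^+ 10)^-1.
  by rewrite /y; field; rewrite gt_eqF.
rewrite ler_wpM2r ?invr_ge0 ?exprn_ge0 ?(ltW D0)// ler_pdivrMr//; lra.
Qed.

(** The crude bound [ln x <= x] gives [T <= 81 kappa D], so [kappa] cancels against the accuracy of
    [solve]. *)
Lemma failure_constant (D kappa : R) (T : nat) (M : R) :
  2 <= D -> 1 <= kappa -> T%:R <= 40 * (ln D + ln kappa) + 1 -> 0 <= M ->
  (3000 * kappa * D ^+ 21)^-1 * (16 * (kappa * M) + 2 * T%:R) <=
  M / D ^+ 21 + 1 / D ^+ 10.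
Proof.
move=> D2 k1 leT M0; have D0 : 0 < D by lra.
have k0 : 0 < kappa by lra.
have lnle (x : R) : 0 < x -> ln x <= x.
  by move=> x0; exact: ltW (ln_sublinear x0).
have lT : T%:R <= 81 * (kappa * D).
  apply: le_trans leT _; have := lnle _ D0; have := lnle _ k0; nra.
have D11 : D <= D ^+ 11 by rewrite -[leLHS]expr1 ler_weXn2l//; lra.
have c0 : 0 < 3000 * kappa * D ^+ 21.
  have c3 : 0 < 3000 :> R by lra.
  exact: mulr_gt0 (mulr_gt0 c3 k0) (exprn_gt0 21 D0).
rewrite mulrC ler_pdivrMr; last exact: c0.
have -> : (M / D ^+ 21 + 1 / D ^+ 10) * (3000 * kappa * D ^+ 21) =
    3000 * (kappa * M) + 3000 * (kappa * D ^+ 11).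
  have p0 : D ^+ 10 != 0 by rewrite gt_eqF// exprn_gt0.
  have q0 : D ^+ 11 != 0 by rewrite gt_eqF// exprn_gt0.
  rewrite (exprD D 10 11); move: (D ^+ 10) (D ^+ 11) p0 q0 => p q p0 q0.
  by field; rewrite p0 q0.
have kM : 0 <= kappa * M by rewrite mulr_ge0// ltW.
have kD : kappa * D <= kappa * D ^+ 11 by rewrite ler_pM2l.
have kD0 : 0 < kappa * D by rewrite mulr_gt0.
move: (kappa * M) (kappa * D) (kappa * D ^+ 11) T%:R kM kD kD0 lT.
by move=> m k k' t; lra.
Qed.

End constants.

Section exponents.
Variables (R : realType) (D kappa : R).
Hypotheses (D2 : 2 <= D) (k1 : 1 <= kappa).

Let D0 : 0 < D. Proof. by rewrite (lt_le_trans _ D2). Qed.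
Let k0 : 0 < kappa. Proof. by rewrite (lt_le_trans _ k1). Qed.
Let kD1 : 1 <= kappa * D.
Proof. by rewrite mulr_ege1// (le_trans _ D2)// ler1n. Qed.

(** [cone_init] with [s = D^2] and [delta = D^-m] yields the power [5 + 2 m] of [D]; a spare factor
    [kappa D >= 1] makes the bound a perfect square. It serves for [(m, n) = (11, 14)] and
    [(4, 7)]. *)
Lemma init_constant (m n : nat) : (5 + 2 * m)%N = (2 * n).-1 -> (0 < n)%N ->
  kappa * (D * (D ^+ 2) ^+ 2) / (D ^+ m)^-1 ^+ 2 <= (kappa * D ^+ n) ^+ 2.
Proof.
move=> mn n0; rewrite exprVn invrK -exprM -exprS -exprM -mulrA -exprD.
rewrite mulnC mn exprMn -exprM.
have -> : kappa ^+ 2 * D ^+ (n * 2) = kappa * D ^+ (2 * n).-1 * (kappa * D).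
  have -> : (n * 2)%N = (2 * n).-1.+1 by rewrite prednK ?muln_gt0// mulnC.
  by rewrite [D ^+ _.+1]exprSr; move: (D ^+ (2 * n).-1) => q; ring.
by rewrite ler_peMr// mulr_ge0 ?exprn_ge0// ltW.
Qed.

(** Starts below level [D^-4]: a failure rate of order [D^-7] times their probability [2 D^-3]. *)
Lemma small_level_constant :
  (D ^+ 14 / D ^+ 21 + 1 / D ^+ 10) * (2 * D * (D ^+ 4)^-1) <= 4 / D ^+ 10.
Proof.
pose u := D^-1; have u0 : 0 <= u by rewrite invr_ge0 ltW.
have u1 : u <= 1 by rewrite invf_le1// (le_trans _ D2)// ler1n.
have Du : D * u = 1 by rewrite mulfV// gt_eqF.
have -> : D ^+ 14 / D ^+ 21 = u ^+ 7.
  by rewrite (exprD D 14 7) invfM mulVKf ?exprVn// gt_eqF ?exprn_gt0.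
rewrite -!exprVn -/u.
have -> : 2 * D * u ^+ 4 = 2 * u ^+ 3 * (D * u) by ring.
rewrite Du mulr1 mul1r.
have -> : (u ^+ 7 + u ^+ 10) * (2 * u ^+ 3) = 2 * u ^+ 10 + 2 * u ^+ 10 * u ^+ 3.
  by ring.
have u3 : u ^+ 3 <= 1 by rewrite exprn_ile1.
have u10 : 0 <= u ^+ 10 by rewrite exprn_ge0.
by move: (u ^+ 10) (u ^+ 3) u3 u10 => p q; nra.
Qed.

Lemma large_level_constant :
  D ^+ 7 / D ^+ 21 + 1 / D ^+ 10 <= 2 / D ^+ 10.
Proof.
pose u := D^-1; have u0 : 0 <= u by rewrite invr_ge0 ltW.
have u1 : u <= 1 by rewrite invf_le1// (le_trans _ D2)// ler1n.
have -> : D ^+ 7 / D ^+ 21 = u ^+ 14.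
  by rewrite (exprD D 7 14) invfM mulVKf ?exprVn// gt_eqF ?exprn_gt0.
rewrite -!exprVn -/u.
have : u ^+ 14 <= u ^+ 10 by rewrite ler_wiXn2l.
by move: (u ^+ 10) (u ^+ 14) => p q; lra.
Qed.

End exponents.

(** * Union bound over the classes of starts *)

Unset Implicit Arguments.

Theorem theorem3p8 (R : realType) :
  exists C1 C2 : R, [/\ 0 < C1, 0 < C2 &
    forall (d : nat) (i1 i2 : 'I_d),
      i1 = 0%N :> nat -> i2 = 1%N :> nat ->
    forall (Sigma : 'M[R]_d) (lam : 'I_d -> R) (v : 'I_d -> 'cV[R]_d),
      psd Sigma -> eigensystem Sigma lam v -> lam i2 < lam i1 ->
    forall lambda : R,
      let gap := (lam i1 - lam i2) / lam i1 in
      (1 + gap / 150) * lam i1 <= lambda <= (1 + gap / 100) * lam i1 ->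
      let B : 'M[R]_d := lambda%:M - Sigma in
      let kappa := cond (invmx B) in
    forall (dX : measure_display) (Xi : measurableType dX)
           (Q : probability Xi R) (solve : 'cV[R]_d -> Xi -> 'cV[R]_d),
      measurable_fun [set: 'cV[R]_d * Xi] (fun p => solve p.1 p.2) ->
      (forall x : 'cV[R]_d, norm2 x = 1 ->
        ('E_Q[fun s => mxnorm B (solve x s - invmx B *m x)] <=
         ((3000 * kappa * d%:R ^+ 21)^-1 *
          mxnorm B ((lambda - quot Sigma x)^-1 *: x - invmx B *m x))%:E)%E) ->
    forall (dO : measure_display) (Omega : measurableType dO)
           (P : probability Omega R) (g : {RV P >-> 'cV[R]_d})
           (xi : nat -> {RV P >-> Xi}),
      std_gaussian g -> fresh_seeds g Q xi ->
    forall T : nat,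
      T = Num.ceil (C1 * (ln d%:R + ln kappa)) :> int ->
      ((1 - C2 / d%:R ^+ 10)%:E <
       P [set w | (dotv (v i1) (iterates solve g xi T w) != 0)%R /\
                  (G B (v i1) (iterates solve g xi T w) <=
                    (Num.sqrt 10)^-1)%R])%E].
Proof.
(* 40 is the exponent in [iteration_count_large]; 2000 exceeds the total failure constant 1736,
   which makes the final inequality strict. *)
exists 40, 2000; split; [lra|lra|].
move=> d i1 i2 i10 i21 Sigma lam v psdS eig lam12 lambda gap lambda_bd B kappa
  dX Xi Q solve msolve Esolve dO Omega P g xi gauss fresh T TE.
have [eigv orth lam_mono] := eig.
have d2 : (2 <= d)%N by have := ltn_ord i2; rewrite i21.
pose D : R := d%:R.
have D2 : 2 <= D by rewrite ler_nat.
(* This gives [lam i1 > 0], so that the division in [gap] can be undone. *)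
have l2 : 0 <= lam i2.
  have := psdS.2 (v i2); rewrite /qform -mulmxA eigv -scalemxAr mxE.
  by rewrite -/(dotv (v i2) (v i2)) orth eqxx mulr1.
have l1 : 0 < lam i1 by lra.
have gapE c : (1 + gap / c) * lam i1 = lam i1 + (lam i1 - lam i2) / c.
  by rewrite mulrDl mul1r mulrAC /gap divfK// gt_eqF.
rewrite !gapE in lambda_bd; have /andP[lambda_ge lambda_le] := lambda_bd.
have lam_le2 i : i != i1 -> lam i <= lam i2.
  move=> ii1; apply: lam_mono; rewrite i21 lt0n -i10.
  by apply: contra_neq ii1 => ?; exact: val_inj.
(* [lambda - lam i1] is at most a hundredth of [lam i1 - lam i2]. *)
have gapP i : i != i1 -> 101 * (lambda - lam i1) <= lambda - lam i.
  by move=> /lam_le2; lra.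
have lam_lt i : lam i < lambda.
  by have [->|/lam_le2] := eqVneq i i1; lra.
have dpred : (d.-1 < d)%N by rewrite prednK// ltnW.
have b1 : 0 < lambda - lam i1 by rewrite subr_gt0.
have kE := @cond_invmx_shift _ _ _ _ _ lambda eig lam_lt i1 (Ordinal dpred) i10 erefl.
rewrite -/B -/kappa in kE.
have bk i : lambda - lam i <= kappa * (lambda - lam i1).
  rewrite kE divfK ?gt_eqF// lerB// lam_mono//=.
  by rewrite -ltnS prednK// ltnW.
have k1 : 1 <= kappa by rewrite -(ler_pM2r b1) mul1r.
have k0 : 0 < kappa by lra.
have D0 : 0 < D by lra.
have TR : T%:R = (Num.ceil (40 * (ln D + ln kappa)))%:~R :> R by rewrite -TE.
have TL : 40 * (ln D + ln kappa) <= T%:R by rewrite TR ceil_ge.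
have TU : T%:R <= 40 * (ln D + ln kappa) + 1.
  by rewrite -lerBlDr TR -[X in _ - X]/(1%:~R) -intrB ltW// ceilB1_lt.
set eps := (3000 * kappa * d%:R ^+ 21)^-1 in Esolve.
have eps0 : 0 <= eps.
  have c3 : 0 < 3000 :> R by lra.
  rewrite invr_ge0; apply: ltW.
  exact: mulr_gt0 (mulr_gt0 c3 k0) (exprn_gt0 21 D0).
pose X := iterates solve g (fun s => xi s) T.
pose b i := lambda - lam i.
have t10 : 0 <= 1 / 10 :> R by lra.
have ten : (Num.sqrt 10)^-1 = Num.sqrt (1 / 10) :> R by rewrite div1r sqrtrV.
rewrite [X in P X](_ : _ = X @^-1` (cone i1 v b (1 / 10))); last first.
  have XE w : exists u, X w = normalize u by rewrite /X; case: (T) => [|t]; eexists.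
  apply/seteqP; split=> w; rewrite -/(X w) /= ten.
    (* [normalize] sends 0 to 0, a value ruled out by the nonzero first coordinate. *)
    move=> XG; have Xn : norm2 (X w) = 1.
      have [u Xu] := XE w; rewrite Xu norm2_normalize//.
      apply: contra_neq (XG.1) => u0.
      by rewrite -/(X w) Xu u0 /normalize scaler0 /dotv mulmx0 mxE.
    exact: (G_le_cone i1 eig lam_lt t10 Xn).1.
  by move=> cX; have [Xn _ _] := cX; exact: (G_le_cone i1 eig lam_lt t10 Xn).2.
have mX : measurable_fun setT X by apply: measurable_iterates.
have mC : measurable (X @^-1` (cone i1 v b (1 / 10))).
  by rewrite -[Y in measurable Y]setTI; apply: mX => //; exact: measurable_cone.
suff bad : (P (~` (X @^-1` cone i1 v b (1 / 10))) <= (1736 / D ^+ 10)%:E)%E.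
  have := bad; rewrite probability_setC//.
  have D10 : 0 < (D ^+ 10)^-1 by rewrite invr_gt0 exprn_gt0.
  rewrite -(@fineK _ (P (X @^-1` cone i1 v b (1 / 10)))) ?fin_num_measure//.
  rewrite -/D -EFinB lee_fin lte_fin.
  by move: (fine _) (D ^+ 10)^-1 D10 => p q; lra.
pose z (x : 'cV[R]_d) := `|dotv (v i1) x|.
pose box : set 'cV[R]_d := [set x | forall j, `|x j 0| <= D ^+ 2].
(* Below [delta1] the start has probability at most [2 / D^10] and is discarded; [delta2] separates
   the rare starts allowed a large initial bound from the typical ones. *)
pose delta1 : R := (D ^+ 11)^-1; pose delta2 : R := (D ^+ 4)^-1.
pose A1 := box `&` [set x | delta1 <= z x] `&` [set x | z x < delta2].
pose A2 := box `&` [set x | delta2 <= z x].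
have delta1_gt0 : 0 < delta1 by rewrite invr_gt0 exprn_gt0.
have delta2_gt0 : 0 < delta2 by rewrite invr_gt0 exprn_gt0.
have vv : dotv (v i1) (v i1) = 1 by rewrite orth eqxx.
have mz : measurable_fun setT z.
  by apply: measurableT_comp => //; apply: measurable_dotv.
have mbox : measurable box.
  rewrite (_ : box = \bigcap_(j in [set: 'I_d]) [set x | `|x j 0| <= D ^+ 2]).
    apply: fin_bigcap_measurable => // j _.
    rewrite -[Y in measurable Y]setTI; apply: measurable_fun_ler => //.
    by apply: measurableT_comp => //; exact: measurable_mx_entry.
  by apply/seteqP; split=> [x xb j _|x xb j]; exact: xb.
have mzge c : measurable [set x | c <= z x].
  by rewrite -[Y in measurable Y]setTI; apply: measurable_fun_ler.
have mzlt c : measurable [set x | z x < c].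
  by rewrite -[Y in measurable Y]setTI; apply: measurable_fun_ltr.
have mA1 : measurable A1 by do 2 apply: measurableI => //.
have mA2 : measurable A2 by apply: measurableI.
have mg (A : set 'cV[R]_d) : measurable A -> measurable (g @^-1` A).
  by move=> mA; rewrite -[Y in measurable Y]setTI; exact: measurable_funP.
have escape M A : 0 <= M -> measurable A ->
    (forall x, A x -> cone i1 v b ((kappa * M) ^+ 2) (normalize x)) ->
    (kappa * M) ^+ 2 / 4 ^+ T <= 1 / 20 ->
    (P [set w | A (g w) /\ ~ cone i1 v b (1 / 10) (X w)] <=
     (M / D ^+ 21 + 1 / D ^+ 10)%:E * P (g @^-1` A))%E.
  move=> M0 mA Ac small; have kM : 0 <= kappa * M by rewrite mulr_ge0// ltW.
  apply: le_trans (le_trans (cone_iterates_escape eig lam_lt gapP T msolve eps0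
    Esolve fresh kM mA Ac) _).
    apply: le_measure; rewrite ?inE.
    - by apply: measurableI; [exact: mg|exact: measurableC].
    - apply: measurableI; first exact: mg.
      apply: measurableC; rewrite -[Y in measurable Y]setTI.
      by apply: mX => //; exact: measurable_cone.
    - move=> w [Aw nc]; split=> //; apply: contra_not nc.
      (* The target [1/10] splits into [1/20] for the decayed initial part and [1/20] for the fixed
         part. *)
      by apply: cone_monotone; [exact: ltW|lra].
  apply: lee_pmul => //.
    by rewrite lee_fin mulr_ge0// addr_ge0// mulr_ge0.
  rewrite lee_fin; exact: failure_constant.
have init delta M x : 0 < delta -> box x -> delta <= z x ->
    kappa * (D * (D ^+ 2) ^+ 2) / delta ^+ 2 <= M ->
    cone i1 v b M (normalize x).
  move=> delta0 bx zx le; apply: cone_monotone le _ _; first exact: ltW.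
  exact: cone_init.
have E1 : (P [set w | A1 (g w) /\ ~ cone i1 v b (1 / 10) (X w)] <=
    (4 / D ^+ 10)%:E)%E.
  apply: le_trans (escape (D ^+ 14) A1 _ mA1 _ _) _.
  - by rewrite exprn_ge0// ltW.
  - move=> x [[bx zx] _]; apply: (init delta1) => //.
    exact: (init_constant D2 k1).
  - exact: iteration_count_large.
  apply: (@le_trans _ _ ((D ^+ 14 / D ^+ 21 + 1 / D ^+ 10)%:E *
    (2 * D * delta2)%:E)%E); last first.
    by rewrite -EFinM lee_fin; exact: small_level_constant.
  apply: lee_pmul => //.
    by rewrite lee_fin addr_ge0// divr_ge0// exprn_ge0// ltW.
  apply: le_trans (std_gaussian_small_ball gauss vv (ltW delta2_gt0)).
  apply: le_measure; rewrite ?inE; [exact: mg|exact: (mg _ (mzlt delta2))|].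
  by move=> w [].
have E2 : (P [set w | A2 (g w) /\ ~ cone i1 v b (1 / 10) (X w)] <=
    (2 / D ^+ 10)%:E)%E.
  apply: le_trans (escape (D ^+ 7) A2 _ mA2 _ _) _.
  - by rewrite exprn_ge0// ltW.
  - move=> x [bx zx]; apply: (init delta2) => //.
    exact: (init_constant D2 k1).
  - apply: le_trans (iteration_count_large D2 k1 TL).
    have D7 : D ^+ 7 <= D ^+ 14 by rewrite ler_weXn2l//; lra.
    have D70 : 0 <= kappa * D ^+ 7 by rewrite mulr_ge0 ?exprn_ge0// ltW.
    have kD : kappa * D ^+ 7 <= kappa * D ^+ 14 by rewrite ler_pM2l.
    apply: ler_wpM2r; first by rewrite invr_ge0 exprn_ge0.
    by rewrite lerXn2r ?nnegrE// (le_trans D70).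
  apply: (@le_trans _ _ ((D ^+ 7 / D ^+ 21 + 1 / D ^+ 10)%:E * 1)%E).
    apply: lee_pmul => //; last exact: probability_le1 (mg _ mA2).
    by rewrite lee_fin addr_ge0// divr_ge0// exprn_ge0// ltW.
  by rewrite mule1 lee_fin; exact: large_level_constant.
have E3 : (P [set w | exists i : 'I_d, (D ^+ 2 < `|g w i 0|)%R] <=
    (1728 / D ^+ 10)%:E)%E.
  apply: le_trans (std_gaussian_tail gauss _) _; first by rewrite sqr_ge0.
  by rewrite lee_fin; exact: gaussian_tail_constant.
have E4 : (P [set w | (z (g w) < delta1)%R] <= (2 / D ^+ 10)%:E)%E.
  apply: le_trans (std_gaussian_small_ball gauss vv (ltW delta1_gt0)) _.
  rewrite lee_fin -/D le_eqVlt; apply/orP; left; apply/eqP.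
  by rewrite /delta1 exprS; field; rewrite gt_eqF// exprn_gt0.
have mN : measurable [set w | exists i : 'I_d, (D ^+ 2 < `|g w i 0|)%R].
  rewrite (_ : [set w | _] = g @^-1` (~` box)); first by apply: mg; exact: measurableC.
  apply/seteqP; split=> w /=.
    by move=> [i lt] bx; have := bx i; rewrite leNgt lt.
  by move=> /existsNP[i /negP]; rewrite -ltNge; exists i.
have mZ := mg _ (mzlt delta1).
have mE (A : set 'cV[R]_d) : measurable A ->
    measurable [set w | A (g w) /\ ~ cone i1 v b (1 / 10) (X w)].
  by move=> mA; apply: measurableI; [exact: mg|exact: measurableC].
(* A failing run starts outside the box, below [delta1], in [A1], or in [A2]. *)
have cover : ~` (X @^-1` cone i1 v b (1 / 10)) `<=`
    ([set w | exists i : 'I_d, (D ^+ 2 < `|g w i 0|)%R] `|`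
     [set w | (z (g w) < delta1)%R]) `|`
    ([set w | A1 (g w) /\ ~ cone i1 v b (1 / 10) (X w)] `|`
     [set w | A2 (g w) /\ ~ cone i1 v b (1 / 10) (X w)]).
  move=> w nc; have [bx|] := pselect (box (g w)); last first.
    by move=> /existsNP[i /negP]; rewrite -ltNge => ?; left; left; exists i.
  have [z1|z1] := ltP (z (g w)) delta1; first by left; right.
  by right; have [z2|z2] := ltP (z (g w)) delta2; [left|right].
apply: le_trans (le_measure P _ _ cover) _; rewrite ?inE.
- exact: measurableC.
- by apply: measurableU; apply: measurableU => //; exact: mE.
apply: le_trans (measureU2 P (measurableU _ _ mN mZ)
  (measurableU _ _ (mE _ mA1) (mE _ mA2))) _.
have -> : (1736 / D ^+ 10)%:E = ((1728 / D ^+ 10)%:E + (2 / D ^+ 10)%:E +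
    ((4 / D ^+ 10)%:E + (2 / D ^+ 10)%:E))%E.
  by rewrite -!EFinD -!mulrDl; congr (_ / _)%:E; lra.
apply: leeD.
  by apply: le_trans (measureU2 P mN mZ) _; exact: leeD.
by apply: le_trans (measureU2 P (mE _ mA1) (mE _ mA2)) _; exact: leeD.
Qed.
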